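(* Let $\{M_i\}_{i\in\mathbb N}$ be a projective system of Banach manifolds with limit $M=\varprojlim M_i$ modelled on $\mathbb F=\varprojlim\mathbb E_i$. If $CM=\varprojlim CM_i$ exists, then $CM$ admits a Fréchet fibre bundle structure over $M=\varprojlim M_i$ with fibre type $\mathcal H^2(\mathbb F,\mathbb F)$.
   Context: Setting. $\{(M_i,\varphi_{ji})\}$ is a projective system of smooth Banach manifolds (with smooth connecting maps $\varphi_{ji}:M_j\to M_i$ for $j\ge i$), where $M_i$ is modelled on the Banach space $\mathbb E_i$ and $\{\mathbb E_i,\rho_{ji}\}$ is a projective system of Banach spaces with continuous linear maps $\rho_{ji}:\mathbb E_j\to\mathbb E_i$ and limit the Fréchet space $\mathbb F=\varprojlim\mathbb E_i$. Every $m=(m_i)\in M=\varprojlim M_i$ is assumed to have a projective system of charts $(U_i,\varphi_i)$ of $M_i$, $m_i\in U_i$, $\varphi_{ji}(U_j)\subseteq U_i$, $\varphi_i\circ\varphi_{ji}=\rho_{ji}\circ\varphi_j$ on $U_j$, such that $U=\varprojlim U_i$ is open in $M$ and $\varphi=\varprojlim\varphi_i$ maps $U$ onto an open subset of $\mathbb F$. Such $(U,\varphi)$ are the (projective limit) charts, which make $M$ a Fréchet manifold modelled on $\mathbb F$. $L^2(\mathbb E,\mathbb E)$ is the space of continuous bilinear maps $\mathbb E\times\mathbb E\to\mathbb E$. A sequence $(B_i)\in\prod_i L^2(\mathbb E_i,\mathbb E_i)$ is said to have a limit ($\varprojlim B_i$ exists) if $B_i\circ(\rho_{ji}\times\rho_{ji})=\rho_{ji}\circ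 B_j$ for all $j\ge i$; $\mathcal H^2(\mathbb F,\mathbb F)$ is the Fréchet space of all such sequences. Christoffel elements. For a Banach manifold $N$ modelled on $\mathbb E$ and $m\in N$, triples $(U,\varphi,B_1)$, $(V,\psi,B_2)$ with charts at $m$ and $B_1,B_2\in L^2(\mathbb E,\mathbb E)$ are equivalent at $m$ if $B_2(DF(u)e_1,DF(u)e_2)=DF(u)B_1(e_1,e_2)+D^2F(u)(e_1,e_2)$ for all $e_1,e_2\in\mathbb E$, where $u=\varphi(m)$, $F=\psi\circ\varphi^{-1}$. The classes $[U,\varphi,B]$ are the Christoffel elements at $m$; $C_m$ is their set and $CN=\bigsqcup_m C_m$, with projection $\pi:CN\to N$; the local maps $[U,\varphi,B]\mapsto(\varphi(m),B)$ make $CN$ a smooth manifold. For $M=\varprojlim M_i$, Christoffel elements at $m=(m_i)$ are classes of triples $[U,\varphi,B]$ with $(U,\varphi)$ a projective limit chart at $m$ and $B=(B_i)\in\mathcal H^2(\mathbb F,\mathbb F)$, two triples being equivalent if their $i$-th components are equivalent at $m_i$ for every $i$; $CM$ is the set of all of these, with projection $\pi:CM\to M$, and with charts $[U,\varphi,B]\mapsto(\varphi(m),B)\in\mathbb F\times\mathcal H^2(\mathbb F,\mathbb F)$. $\varprojlim CM_i$ is the set of sequences $(\gamma_i)$, $\gamma_i\in CM_i$, lying over some $m=(m_i)\in M$, such that for a projective limit chart at $m$ one has $\gamma_i=[U_i,\varphi_i,B_i]$ with $\varprojlim B_i$ existing. It is identified with $CM$ by $[U,\varphi,B]\mapsto([U_i,\varphi_i,B_i])_i$.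 *)

(* Defs.v *)
From HB Require Import structures.
From mathcomp Require Import all_boot all_order all_algebra.
From mathcomp Require Import all_classical all_reals all_analysis.

Set Implicit Arguments.
Unset Strict Implicit.
Unset Printing Implicit Defensive.

Import Order.TTheory GRing.Theory Num.Theory.
Import numFieldNormedType.Exports.

Local Open Scope classical_set_scope.
Local Open Scope ring_scope.

Section operator_spaces.
Context (R : realType) (T : Type) (W : normedModType R).

(* A vector space [op_set] of functions T -> W, bounded on [op_ball], on which
   the supremum over [op_ball] is a norm; [optype] is the resulting normed
   space.  It is used with [op_ball] a closed unit ball, for the operator norm
   of linear and of bilinear maps. *)
Record opspace := OpSpace {
  op_set : set (T -> W);
  op_ball : set T;
  op_set0 : op_set (fun=> 0);
  op_setD : forall f g, op_set f -> op_set g -> op_set (fun t => f t + g t);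
  op_setZ : forall a f, op_set f -> op_set (fun t => a *: f t);
  op_ball_nonempty : op_ball !=set0;
  op_bounded : forall f, op_set f ->
    exists K : R, forall t, op_ball t -> `|f t| <= K;
  op_separated : forall f, op_set f ->
    (forall t, op_ball t -> f t = 0) -> forall t, f t = 0 }.

Record optype (O : opspace) := OpType {
  opfun :> T -> W;
  opfunP : op_set O opfun }.

Variable O : opspace.

HB.instance Definition _ := gen_eqMixin (optype O).
HB.instance Definition _ := gen_choiceMixin (optype O).

Lemma optype_ext (f g : optype O) : (forall t, f t = g t) -> f = g.
Proof.
case: f g => [f Pf] [g Pg] /= /funext fg; case: _ / fg Pg => Pg.
by congr OpType; exact: Prop_irrelevance.
Qed.

Definition optype0 := OpType (op_set0 O).
Definition optypeD (f g : optype O) := OpType (op_setD (opfunP f) (opfunP g)).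
Definition optypeZ (a : R) (f : optype O) := OpType (op_setZ a (opfunP f)).
Definition optypeN (f : optype O) := optypeZ (-1) f.

Fact optypeDA : associative optypeD.
Proof. by move=> f g h; apply: optype_ext => t /=; rewrite addrA. Qed.
Fact optypeDC : commutative optypeD.
Proof. by move=> f g; apply: optype_ext => t /=; rewrite addrC. Qed.
Fact optypeD0 : left_id optype0 optypeD.
Proof. by move=> f; apply: optype_ext => t /=; rewrite add0r. Qed.
Fact optypeND : left_inverse optype0 optypeN optypeD.
Proof. by move=> f; apply: optype_ext => t /=; rewrite scaleN1r addNr. Qed.

HB.instance Definition _ := GRing.isZmodule.Build (optype O)
  optypeDA optypeDC optypeD0 optypeND.

Fact optypeZA a b (f : optype O) :
  optypeZ a (optypeZ b f) = optypeZ (a * b) f.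
Proof. by apply: optype_ext => t /=; rewrite scalerA. Qed.
Fact optypeZ1 : left_id 1 optypeZ.
Proof. by move=> f; apply: optype_ext => t /=; rewrite scale1r. Qed.
Fact optypeZDr : right_distributive optypeZ +%R.
Proof. by move=> a f g; apply: optype_ext => t /=; rewrite scalerDr. Qed.
Fact optypeZDl (f : optype O) : {morph optypeZ^~ f : a b / a + b}.
Proof. by move=> a b; apply: optype_ext => t /=; rewrite scalerDl. Qed.

HB.instance Definition _ := GRing.Zmodule_isLmodule.Build R (optype O)
  optypeZA optypeZ1 optypeZDr optypeZDl.

Definition opnorm (f : optype O) : R := sup [set `|f t| | t in op_ball O].

Lemma opnorm_has_sup (f : optype O) : has_sup [set `|f t| | t in op_ball O].
Proof.
split; first by have [t Ot] := op_ball_nonempty O; exists `|f t|; exists t.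
have [K fK] := op_bounded (opfunP f).
by exists K => _ [t Ot <-]; exact: fK.
Qed.

Lemma opnorm_ub (f : optype O) t : op_ball O t -> `|f t| <= opnorm f.
Proof.
move=> Ot; apply: ub_le_sup; first by case: (opnorm_has_sup f).
by exists t.
Qed.

Lemma opnorm_le (f : optype O) (K : R) :
  (forall t, op_ball O t -> `|f t| <= K) -> opnorm f <= K.
Proof.
move=> fK; apply: ge_sup; first by case: (opnorm_has_sup f).
by move=> _ [t Ot <-]; exact: fK.
Qed.

Fact opnormD (f g : optype O) : opnorm (f + g) <= opnorm f + opnorm g.
Proof.
apply: opnorm_le => t Ot; apply: le_trans (ler_normD _ _) _.
by rewrite lerD// opnorm_ub.
Qed.

Fact opnormZ a (f : optype O) : opnorm (a *: f) = `|a| * opnorm f.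
Proof.
have le1 b (g : optype O) : opnorm (b *: g) <= `|b| * opnorm g.
  apply: opnorm_le => t Ot; rewrite [X in `|X|]/= normrZ.
  by rewrite ler_wpM2l// opnorm_ub.
apply/eqP; rewrite eq_le le1/=.
have [->|a0] := eqVneq a 0.
  rewrite normr0 mul0r; have [t Ot] := op_ball_nonempty O.
  exact: le_trans (opnorm_ub _ Ot).
rewrite -ler_pdivlMl ?normr_gt0// -normfV.
by rewrite -{1}(scale1r f) -(mulVf a0) -scalerA le1.
Qed.

Fact opnorm_eq0 (f : optype O) : opnorm f = 0 -> f = 0.
Proof.
move=> f0; apply: optype_ext; apply: (op_separated (opfunP f)) => t Ot.
by apply/eqP; rewrite -normr_le0 -f0 opnorm_ub.
Qed.

HB.instance Definition _ := @Lmodule_isNormed.Build R (optype O)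
  opnorm opnormD opnormZ opnorm_eq0.

End operator_spaces.

Section contlin.
Context (R : realType).
Implicit Types (U V W : normedModType R).

Lemma normed_ball_bounded V W (g : V -> W) (n : nat) : g 0 = 0 ->
  (forall (a : R) x, 0 <= a -> `|g (a *: x)| = a ^+ n * `|g x|) ->
  {for 0, continuous g} ->
  exists K : R, forall x, `|x| <= 1 -> `|g x| <= K.
Proof.
move=> g0 gZ /(@cvgrPdist_le _ _ _ _ _ _ _) /(_ 1 ltr01).
rewrite g0 => /nbhs_ballP[e /= e0 ge].
have e20 : 0 < e / 2 by rewrite divr_gt0.
exists ((e / 2) ^- n) => x x1.
have : `|g ((e / 2) *: x)| <= 1.
  rewrite -normrN -sub0r; apply: ge.
  rewrite -ball_normE /ball_/= sub0r normrN normrZ gtr0_norm//.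
  apply: le_lt_trans (_ : e / 2 * 1 < e); first by rewrite ler_wpM2l// ltW.
  by rewrite mulr1 ltr_pdivrMr// ltr_pMr// ltr1n.
rewrite (gZ _ _ (ltW e20)) => gx.
by rewrite -[leRHS]mulr1 ler_pdivlMl ?exprn_gt0.
Qed.

Lemma normed_scale_unit V (x : V) : exists a : R, a != 0 /\ `|a *: x| <= 1.
Proof.
exists (`|x| + 1)^-1; have x0 : 0 < `|x| + 1 by rewrite ltr_wpDl.
rewrite invr_neq0 ?gt_eqF//; split=> //.
by rewrite normrZ gtr0_norm ?invr_gt0// ler_pdivrMl// mulr1 lerDl.
Qed.

Definition contlin_set V W : set (V -> W) :=
  [set f | linear f /\ continuous f].

Definition contbil_set V W : set (V * V -> W) :=
  [set f | [/\ forall y, linear (fun x => f (x, y)),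
               forall x, linear (fun y => f (x, y)) & continuous f]].

Lemma linear_fun0 V W (f : V -> W) : linear f -> f 0 = 0.
Proof.
by move=> /(_ (-1) 0 0); rewrite !scaleN1r oppr0 addr0 addNr.
Qed.

Lemma linear_funZ V W (f : V -> W) : linear f ->
  forall a x, f (a *: x) = a *: f x.
Proof.
by move=> fL a x; move: (fL a x 0); rewrite addr0 (linear_fun0 fL) addr0.
Qed.

Lemma linear_cst0 V W : linear (fun _ : V => 0 : W).
Proof. by move=> a x y; rewrite scaler0 addr0. Qed.

Lemma linear_funD V W (f g : V -> W) : linear f -> linear g ->
  linear (fun x => f x + g x).
Proof. by move=> fL gL a x y; rewrite /= fL gL scalerDr addrACA. Qed.

Lemma linear_funS V W (b : R) (f : V -> W) : linear f ->
  linear (fun x => b *: f x).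
Proof. by move=> fL a x y; rewrite fL scalerDr !scalerA [a * b]mulrC. Qed.

Section def.
Context (V W : normedModType R).
Let S := @contlin_set V W.
Let B := [set x : V | `|x| <= 1].

Fact contlin0 : S (fun=> 0).
Proof. by split; [exact: linear_cst0|move=> x; exact: cvg_cst]. Qed.
Fact contlinD f g : S f -> S g -> S (fun t => f t + g t).
Proof.
move=> [fL fC] [gL gC]; split; first exact: linear_funD.
by move=> x; apply: cvgD; [exact: fC|exact: gC].
Qed.
Fact contlinZ a f : S f -> S (fun t => a *: f t).
Proof.
move=> [fL fC]; split; first exact: linear_funS.
by move=> x; apply: cvgZl_tmp; exact: fC.
Qed.
Fact contlin_ball : B !=set0.
Proof. by exists 0; rewrite /B/= normr0. Qed.
Fact contlin_bounded f : S f -> exists K : R, forall t, B t -> `|f t| <= K.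
Proof.
move=> [fL fC]; apply: (@normed_ball_bounded _ _ f 1); last exact: fC.
  exact: linear_fun0.
by move=> a x a0; rewrite linear_funZ// normrZ ger0_norm.
Qed.
Fact contlin_sep f : S f -> (forall t, B t -> f t = 0) -> forall t, f t = 0.
Proof.
move=> [fL _] f0 t; have [a [a0 at1]] := normed_scale_unit t.
have /eqP := f0 _ at1; rewrite (linear_funZ fL) scaler_eq0 (negbTE a0)/=.
by move/eqP.
Qed.

Definition contlin_space : opspace V W := OpSpace contlin0 contlinD contlinZ
  contlin_ball contlin_bounded contlin_sep.

Let S2 := @contbil_set V W.
Let B2 := [set x : V * V | `|x| <= 1].

Fact contbil0 : S2 (fun=> 0).
Proof.
by split; [move=> y; exact: linear_cst0|move=> y; exact: linear_cst0|
  move=> x; exact: cvg_cst].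
Qed.
Fact contbilD f g : S2 f -> S2 g -> S2 (fun t => f t + g t).
Proof.
move=> [fL fL' fC] [gL gL' gC]; split=> [y|y|x].
- exact: linear_funD (fL y) (gL y).
- exact: linear_funD (fL' y) (gL' y).
- by apply: cvgD; [exact: fC|exact: gC].
Qed.
Fact contbilZ a f : S2 f -> S2 (fun t => a *: f t).
Proof.
move=> [fL fL' fC]; split=> [y|y|x].
- exact: linear_funS (fL y).
- exact: linear_funS (fL' y).
- by apply: cvgZl_tmp; exact: fC.
Qed.
Fact contbil_ball : B2 !=set0.
Proof. by exists 0; rewrite /B2/= normr0. Qed.
Lemma contbil_funZ f : S2 f -> forall (a : R) x, f (a *: x) = a ^+ 2 *: f x.
Proof.
move=> [fL fL' _] a [x y].
have -> : a *: ((x, y) : V * V) = (a *: x, a *: y) by [].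
rewrite (linear_funZ (fL _)).
by rewrite (linear_funZ (fL' _)) scalerA -expr2.
Qed.
Fact contbil_bounded f : S2 f -> exists K : R, forall t, B2 t -> `|f t| <= K.
Proof.
move=> fS; have [fL _ fC] := fS.
apply: (@normed_ball_bounded _ _ f 2); last exact: fC.
  exact: (linear_fun0 (fL 0)).
by move=> a x a0; rewrite contbil_funZ// normrZ ger0_norm// exprn_ge0.
Qed.
Fact contbil_sep f : S2 f -> (forall t, B2 t -> f t = 0) -> forall t, f t = 0.
Proof.
move=> fS f0 t; have [a [a0 at1]] := normed_scale_unit t.
have /eqP := f0 _ at1; rewrite contbil_funZ// scaler_eq0 expf_eq0 (negbTE a0)/=.
by move/eqP.
Qed.

Definition contbil_space : opspace (V * V) W := OpSpace contbil0 contbilD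
  contbilZ contbil_ball contbil_bounded contbil_sep.

End def.
End contlin.

Section subprod.
Context (R : realType) (V : nat -> tvsType R).

Record linset := LinSet {
  lset :> set (prod_topology V);
  lset0 : lset (fun=> 0);
  lsetD : forall x y, lset x -> lset y -> lset (fun i => x i + y i);
  lsetZ : forall a x, lset x -> lset (fun i => a *: x i) }.

(* The linear subspace [S] of the product of the V i, with the topology and the
   uniformity induced by the product ones. *)
Definition subprod (S : linset) : Type := set_type (lset S).

Variable S : linset.
HB.instance Definition _ := Uniform.copy (subprod S) (set_type (lset S)).

Definition subprod_coord (x : subprod S) : forall i, V i := set_val x.

Lemma subprod_coordP (x : subprod S) : lset S (subprod_coord x).
Proof. exact: set_valP. Qed.

Definition SubProd (x : forall i, V i) (Sx : lset S x) : subprod S :=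
  SigSub (mem_set Sx).

Lemma subprod_ext (x y : subprod S) :
  (forall i, subprod_coord x i = subprod_coord y i) -> x = y.
Proof. by move=> xy; apply: val_inj; apply: functional_extensionality_dep. Qed.

Definition subprod0 := SubProd (lset0 S).
Definition subprodD (x y : subprod S) :=
  SubProd (lsetD (subprod_coordP x) (subprod_coordP y)).
Definition subprodZ (a : R) (x : subprod S) :=
  SubProd (lsetZ a (subprod_coordP x)).
Definition subprodN (x : subprod S) := subprodZ (-1) x.

Lemma coord0E i : subprod_coord subprod0 i = 0. Proof. by []. Qed.
Lemma coordDE x y i :
  subprod_coord (subprodD x y) i = subprod_coord x i + subprod_coord y i.
Proof. by []. Qed.
Lemma coordZE a x i : subprod_coord (subprodZ a x) i = a *: subprod_coord x i.
Proof. by []. Qed.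
Let coordE := (coord0E, coordDE, coordZE).

Fact subprodDA : associative subprodD.
Proof. by move=> f g h; apply: subprod_ext => t /=; rewrite !coordE addrA. Qed.
Fact subprodDC : commutative subprodD.
Proof. by move=> f g; apply: subprod_ext => t; rewrite !coordE addrC. Qed.
Fact subprodD0 : left_id subprod0 subprodD.
Proof. by move=> f; apply: subprod_ext => t; rewrite !coordE add0r. Qed.
Fact subprodND : left_inverse subprod0 subprodN subprodD.
Proof.
by move=> f; apply: subprod_ext => t; rewrite /subprodN !coordE scaleN1r addNr.
Qed.

HB.instance Definition _ := GRing.isZmodule.Build (subprod S)
  subprodDA subprodDC subprodD0 subprodND.

Fact subprodZA a b (f : subprod S) :
  subprodZ a (subprodZ b f) = subprodZ (a * b) f.
Proof. by apply: subprod_ext => t; rewrite !coordE scalerA. Qed.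
Fact subprodZ1 : left_id 1 subprodZ.
Proof. by move=> f; apply: subprod_ext => t; rewrite !coordE scale1r. Qed.
Fact subprodZDr : right_distributive subprodZ +%R.
Proof. by move=> a f g; apply: subprod_ext => t; rewrite !coordE scalerDr. Qed.
Fact subprodZDl (f : subprod S) : {morph subprodZ^~ f : a b / a + b}.
Proof. by move=> a b; apply: subprod_ext => t; rewrite !coordE scalerDl. Qed.

HB.instance Definition _ := GRing.Zmodule_isLmodule.Build R (subprod S)
  subprodZA subprodZ1 subprodZDr subprodZDl.

Lemma subprod_coord_continuous i :
  continuous (fun x : subprod S => subprod_coord x i).
Proof.
move=> x.
apply: (@cvg_comp (subprod S) (prod_topology V) (V i) (@subprod_coord)
  (@proj nat V i) (nbhs x) (nbhs (subprod_coord x : prod_topology V))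
  (nbhs (subprod_coord x i))).
  exact: (@initial_continuous (set_type (lset S)) (prod_topology V) set_val).
exact: (@proj_continuous nat V i).
Qed.

Lemma subprod_cvg (F : set_system (subprod S)) (x : subprod S) : Filter F ->
  (forall i,
    (fun y : subprod S => subprod_coord y i) @ F --> subprod_coord x i) ->
  F --> x.
Proof.
move=> FF Fx.
have /= FP : (fun y : subprod S => (subprod_coord y : prod_topology V)) @ F -->
    (subprod_coord x : prod_topology V).
  apply/cvg_sup => i A [_ [[B oB <-] Bx] BA].
  have : nbhs (subprod_coord x i) B := @open_nbhs_nbhs (V i) _ _ (conj oB Bx).
  move=> /(Fx i); apply: (filterS (F := F)) => y By; exact: BA.
move=> A [_ [[B oB <-] Bx] BA].
have /FP : nbhs (subprod_coord x : prod_topology V) B :=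
  @open_nbhs_nbhs (prod_topology V) _ _ (conj oB Bx).
by apply: (filterS (F := F)) => y By; exact: BA.
Qed.

Fact subprod_add_continuous :
  continuous (fun x : subprod S * subprod S => x.1 + x.2).
Proof.
move=> x; apply: subprod_cvg => i.
rewrite -fmap_comp.
apply: (@continuous2_cvg _ _ _ _ _ _
  (fun y : subprod S * subprod S => subprod_coord y.1 i)
  (fun y : subprod S * subprod S => subprod_coord y.2 i)
  (fun a b : V i => a + b)).
- exact: (@add_continuous (V i) (subprod_coord x.1 i, subprod_coord x.2 i)).
- by apply: (@cvg_comp _ _ _ fst (fun y => subprod_coord y i));
    [exact: cvg_fst|exact: subprod_coord_continuous].
- by apply: (@cvg_comp _ _ _ snd (fun y => subprod_coord y i));
    [exact: cvg_snd|exact: subprod_coord_continuous].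
Qed.

Fact subprod_scale_continuous :
  continuous (fun z : R^o * subprod S => z.1 *: z.2).
Proof.
move=> x; apply: subprod_cvg => i.
rewrite -fmap_comp.
apply: (@continuous2_cvg _ _ _ _ _ _
  (fun y : R^o * subprod S => y.1)
  (fun y : R^o * subprod S => subprod_coord y.2 i)
  (fun (a : R^o) (b : V i) => a *: b)).
- exact: (@scale_continuous R (V i) (x.1, subprod_coord x.2 i)).
- exact: cvg_fst.
- by apply: (@cvg_comp _ _ _ snd (fun y => subprod_coord y i));
    [exact: cvg_snd|exact: subprod_coord_continuous].
Qed.

Let cvxopen (b : set (subprod S)) := open b /\ convex_set b.

Lemma cvxopenI b c : cvxopen b -> cvxopen c -> cvxopen (b `&` c).
Proof.
move=> [ob cb] [oc cc]; split; first exact: openI.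
move=> x y l /[!inE] -[bx cx] [by_ cy]; split.
  by apply/set_mem/cb; exact/mem_set.
by apply/set_mem/cc; exact/mem_set.
Qed.

Fact subprod_locally_convex :
  exists2 B : set_system (subprod S),
    (forall b, b \in B -> convex_set b) & basis B.
Proof.
exists cvxopen; first by move=> b; rewrite inE => -[].
split; first by move=> b [].
move=> x.
have FF : Filter (filter_from [set U | cvxopen U /\ U x] id).
  apply: filter_from_filter.
    exists setT; split => //; split; first exact: openT.
    by move=> ? ? ? _ _; rewrite inE.
  move=> b c [cb bx] [cc cx]; exists (b `&` c) => //.
  by split => //; exact: cvxopenI.
apply: subprod_cvg => i A.
have [B Bc [Bo Bb]] := @locally_convex R (V i).
move=> /(Bb (subprod_coord x i))[b [Bbb bx] bA].
exists ((fun y => subprod_coord y i) @^-1` b); last by move=> y /bA.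
split => //; split.
  by apply: open_comp => [y _|]; [exact: subprod_coord_continuous|exact: Bo].
by move=> y z l /[!inE] yb zb; apply/set_mem/(Bc b); exact/mem_set.
Qed.

HB.instance Definition _ := PreTopologicalNmodule_isTopologicalNmodule.Build
  (subprod S) subprod_add_continuous.
HB.instance Definition _ := TopologicalNmodule_isTopologicalLmodule.Build
  R (subprod S) subprod_scale_continuous.
HB.instance Definition _ :=
  Uniform_isTvs.Build R (subprod S) subprod_locally_convex.

End subprod.

Notation contlin V W := (optype (contlin_space V W)).
Notation contbil V W := (optype (contbil_space V W)).

(* C^k in the Fréchet sense on an open set D of a normed space: the derivative
   is again C^(k-1) as a map into the operator-normed space of continuous
   linear maps. *)
Fixpoint banach_Ck (R : realType) (k : nat) (V W : normedModType R)
    (D : set V) (f : V -> W) {struct k} : Prop :=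
  match k with
  | 0 => {within D, continuous f}
  | k'.+1 => exists Df : V -> contlin V W,
      (forall x, D x -> differentiable f x /\ forall v, 'd f x v = Df x v) /\
      banach_Ck k' D Df
  end.

Definition banach_smooth (R : realType) (V W : normedModType R)
    (D : set V) (f : V -> W) : Prop :=
  forall k, banach_Ck k D f.

(* C^k on an open set D of a locally convex space, in the sense of
   Michal-Bastiani and Hamilton: the directional derivatives exist and
   (x, v) |-> df x v is C^(k-1) on D * V. *)
Fixpoint frechet_Ck (R : realType) (k : nat) (V W : tvsType R)
    (D : set V) (f : V -> W) {struct k} : Prop :=
  {within D, continuous f} /\
  match k with
  | 0 => True
  | k'.+1 => exists df : V * V -> W,
      (forall x v, D x ->
        (fun h : R => h^-1 *: (f (x + h *: v) - f x)) @ 0^' --> df (x, v)) /\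
      @frechet_Ck R k' (V * V)%type W (D `*` setT) df
  end.

Definition frechet_smooth (R : realType) (V W : tvsType R)
    (D : set V) (f : V -> W) : Prop :=
  forall k, frechet_Ck k D f.

(* A locally convex space that is Hausdorff, first countable (hence metrizable)
   and complete. *)
Definition is_frechet_space (R : realType) (V : tvsType R) : Prop :=
  [/\ hausdorff_space V,
      exists B : nat -> set V, (forall n, nbhs (0 : V) (B n)) /\
        forall U : set V, nbhs (0 : V) U -> exists n, B n `<=` U
    & forall u : nat -> V,
        (forall U : set V, nbhs (0 : V) U ->
          exists N, forall m n, (N <= m)%N -> (N <= n)%N -> U (u m - u n)) ->
        exists l : V, u @ \oo --> l].

(* [cmap] and [cinv] are total functions: [cmap] is only meaningful on [cdom],
   and [cinv] on the image of [cdom]. *)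
Record chart (N E : topologicalType) := Chart {
  cdom : set N;
  cmap :> N -> E;
  cinv : E -> N;
  cdom_open : open cdom;
  cimg_open : open (cmap @` cdom);
  cmapK : forall x, cdom x -> cinv (cmap x) = x;
  cmap_continuous : {within cdom, continuous cmap};
  cinv_continuous : {within cmap @` cdom, continuous cinv} }.

Section manifolds.
Context (N E : topologicalType) (smooth : set E -> (E -> E) -> Prop).

Definition chart_change (c d : chart N E) : E -> E := d \o cinv c.

Definition compatible (c d : chart N E) : Prop :=
  smooth (c @` (cdom c `&` cdom d)) (chart_change c d).

Definition is_atlas (A : set (chart N E)) : Prop :=
  (forall x, exists2 c, A c & cdom c x) /\
  (forall c d, A c -> A d -> compatible c d).

Definition max_atlas (A : set (chart N E)) : set (chart N E) :=
  [set c | forall d, A d -> compatible c d /\ compatible d c].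
End manifolds.

Definition manifold_smooth_on (N E N' E' : topologicalType)
    (smooth : set E -> (E -> E') -> Prop)
    (A : set (chart N E)) (A' : set (chart N' E')) (D : set N) (f : N -> N') :=
  {within D, continuous f} /\
  forall c d, A c -> A' d ->
    smooth (c @` (cdom c `&` D `&` f @^-1` cdom d)) (d \o f \o cinv c).

Section product_chart.
Context (N E H : topologicalType) (c : chart N E).

Let dom : set (N * H) := cdom c `*` setT.
Let mp (z : N * H) : E * H := (c z.1, z.2).
Let inv (z : E * H) : N * H := (cinv c z.1, z.2).

Lemma open_cylinder (X : topologicalType) (D : set X) :
  open D -> open (D `*` setT : set (X * H)).
Proof.
move=> oD; rewrite (_ : _ `*` _ = fst @^-1` D); last first.
  by apply/seteqP; split => [z []|z ?].
by apply: open_comp => // z _; exact: cvg_fst.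
Qed.

Lemma within_cylinder (X Y : topologicalType) (D : set X) (f : X -> Y) :
  {within D, continuous f} -> open D ->
  {within (D `*` setT : set (X * H)),
    continuous (fun z : X * H => (f z.1, z.2))}.
Proof.
move=> + oD; rewrite !continuous_open_subspace//; last exact: open_cylinder.
move=> fC z /[!inE] -[Dz _].
apply: cvg_pair; last exact: cvg_snd.
apply: (@cvg_comp _ _ _ fst f); first exact: cvg_fst.
by apply: fC; rewrite inE.
Qed.

Let img : mp @` dom = (c @` cdom c) `*` setT.
Proof.
apply/seteqP; split => [_ [z [zc _] <-]|z [[x xc xz] _]].
  by split=> //; exists z.1.
by exists (x, z.2) => //; rewrite /mp/= xz; case: z {xz}.
Qed.

Fact prod_chart_dom_open : open dom.
Proof. exact: open_cylinder (cdom_open c). Qed.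
Fact prod_chart_img_open : open (mp @` dom).
Proof. by rewrite img; exact: open_cylinder (cimg_open c). Qed.
Fact prod_chartK z : dom z -> inv (mp z) = z.
Proof. by move=> [zc _]; rewrite /inv/= cmapK//; case: z {zc}. Qed.
Fact prod_chart_continuous : {within dom, continuous mp}.
Proof. exact: (within_cylinder (@cmap_continuous _ _ c) (cdom_open c)). Qed.
Fact prod_chart_inv_continuous : {within mp @` dom, continuous inv}.
Proof.
by rewrite img; exact: (within_cylinder (@cinv_continuous _ _ c) (cimg_open c)).
Qed.

Definition prod_chart : chart (N * H)%type (E * H)%type :=
  Chart prod_chart_dom_open prod_chart_img_open prod_chartK
    prod_chart_continuous prod_chart_inv_continuous.
End product_chart.

Definition is_frechet_manifold (R : realType) (V : tvsType R)
    (X : topologicalType) (A : set (chart X V)) : Prop :=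
  is_frechet_space V /\ is_atlas (@frechet_smooth R V V) A.

(* Locally trivial Fréchet fibre bundle [p : T -> X] with fibre type [H]; over
   [U], [tau] is a diffeomorphism of [p @^-1` U] onto [U * H] with inverse
   [sigma]. *)
Definition is_frechet_fibre_bundle (R : realType) (V W H : tvsType R)
    (X T : topologicalType) (AX : set (chart X V)) (AT : set (chart T W))
    (p : T -> X) : Prop :=
  let AXH := [set prod_chart H c | c in AX] in
  [/\ is_frechet_manifold AX, is_frechet_manifold AT, is_frechet_space H,
      set_surj setT setT p /\
        manifold_smooth_on (@frechet_smooth R W V) AT AX setT p
    & forall x : X, exists U : set X, [/\ open U, U x &
        exists (tau : T -> X * H) (sigma : X * H -> T),
        [/\ manifold_smooth_on (@frechet_smooth R W (V * H)%type) AT AXH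
              (p @^-1` U) tau,
            manifold_smooth_on (@frechet_smooth R (V * H)%type W) AXH AT
              (U `*` setT) sigma,
            forall t, U (p t) -> (tau t).1 = p t /\ sigma (tau t) = t
          & forall y h, U y ->
              p (sigma (y, h)) = y /\ tau (sigma (y, h)) = (y, h)]]].

Record banach_manifold (R : realType) (E : completeNormedModType R) :=
  BanachManifold {
  bm_space :> topologicalType;
  bm_atlas : set (chart bm_space E);
  bm_atlasP : is_atlas (@banach_smooth R E E) bm_atlas }.

Arguments bm_atlas {R E} b _.

Section christoffel.
Context (R : realType) (E : completeNormedModType R) (N : banach_manifold E).

Definition manifold_chart : set (chart N E) :=
  max_atlas (@banach_smooth R E E) (bm_atlas N).

(* A pair [(c, B)] stands for the triple (U, phi, B) with [c] = (U, phi). *)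
Definition christoffel_equiv (m : N) (s t : chart N E * contbil E E) : Prop :=
  let F := chart_change s.1 t.1 in
  let u := s.1 m in
  forall e1 e2 : E,
    t.2 ('d F u e1, 'd F u e2) =
    'd F u (s.2 (e1, e2)) + 'd (fun x => 'd F x e2) u e1.

Definition christoffel_class (m : N) (c : chart N E) (B : contbil E E) :
    set (chart N E * contbil E E) :=
  [set t | [/\ manifold_chart t.1, cdom t.1 m
              & christoffel_equiv m (c, B) t]].

Record christoffel := Christoffel {
  chr_pt : N;
  chr_class : set (chart N E * contbil E E);
  chr_classP : exists c B, [/\ manifold_chart c, cdom c chr_pt
    & chr_class = christoffel_class chr_pt c B] }.

Definition is_christoffel (g : christoffel) (m : N) (c : chart N E)
    (B : contbil E E) : Prop :=
  chr_pt g = m /\ chr_class g = christoffel_class m c B.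
End christoffel.

(* The connecting map [bs_map h] : E_j -> E_i exists only for h : i <= j. *)
Record banach_system (R : realType) := BanachSystem {
  bs_space :> nat -> completeNormedModType R;
  bs_map : forall i j, (i <= j)%N -> {linear bs_space j -> bs_space i};
  bs_map_continuous : forall i j (h : (i <= j)%N), continuous (bs_map h);
  bs_map_id : forall i (h : (i <= i)%N) x, bs_map h x = x;
  bs_map_comp : forall i j k (hij : (i <= j)%N) (hjk : (j <= k)%N)
    (hik : (i <= k)%N) x, bs_map hij (bs_map hjk x) = bs_map hik x }.

Arguments bs_map {R} b {i j} h.

Section limits.
Context (R : realType) (E : banach_system R).

Definition bs_thread : set (prod_topology (fun i => E i : tvsType R)) :=
  [set x | forall i j (h : (i <= j)%N), bs_map E h (x j) = x i].

Fact bs_thread0 : bs_thread (fun=> 0).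
Proof. by move=> i j h; rewrite linear0. Qed.
Fact bs_threadD x y : bs_thread x -> bs_thread y ->
  bs_thread (fun i => x i + y i).
Proof. by move=> xP yP i j h; rewrite linearD xP yP. Qed.
Fact bs_threadZ a x : bs_thread x -> bs_thread (fun i => a *: x i).
Proof. by move=> xP i j h; rewrite linearZ xP. Qed.

Definition bs_lim : tvsType R :=
  subprod (LinSet bs_thread0 bs_threadD bs_threadZ).

(* Sequences (B_i) with B_i o (rho_ji * rho_ji) = rho_ji o B_j. *)
Definition H2_set :
    set (prod_topology (fun i => contbil (E i) (E i) : tvsType R)) :=
  [set B | forall i j (h : (i <= j)%N) e1 e2,
    (B i : contbil (E i) (E i)) (bs_map E h e1, bs_map E h e2) =
    bs_map E h ((B j : contbil (E j) (E j)) (e1, e2))].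

Fact H2_set0 : H2_set (fun=> 0).
Proof. by move=> i j h e1 e2; rewrite /= linear0. Qed.
Fact H2_setD x y : H2_set x -> H2_set y -> H2_set (fun i => x i + y i).
Proof. by move=> xP yP i j h e1 e2; rewrite /= linearD xP yP. Qed.
Fact H2_setZ a x : H2_set x -> H2_set (fun i => a *: x i).
Proof. by move=> xP i j h e1 e2; rewrite /= linearZ xP. Qed.

Definition H2 : tvsType R := subprod (LinSet H2_set0 H2_setD H2_setZ).
End limits.

Record manifold_system (R : realType) := ManifoldSystem {
  ms_model : banach_system R;
  ms_space :> forall i : nat, banach_manifold (ms_model i);
  ms_map : forall i j, (i <= j)%N -> ms_space j -> ms_space i;
  ms_map_smooth : forall i j (h : (i <= j)%N),
    manifold_smooth_on (@banach_smooth R (ms_model j) (ms_model i))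
      (bm_atlas (ms_space j)) (bm_atlas (ms_space i)) setT (ms_map h);
  ms_map_id : forall i (h : (i <= i)%N) x, ms_map h x = x;
  ms_map_comp : forall i j k (hij : (i <= j)%N) (hjk : (j <= k)%N)
    (hik : (i <= k)%N) x, ms_map hij (ms_map hjk x) = ms_map hik x }.

Arguments ms_map {R} m {i j} h _.

Section limit_manifold.
Context (R : realType) (S : manifold_system R).
Local Notation E := (ms_model S).
Local Notation F := (bs_lim E).

Definition ms_lim : topologicalType :=
  set_type [set m : prod_topology (fun i => S i : topologicalType) |
    forall i j (h : (i <= j)%N), ms_map S h (m j) = m i].

Definition lim_coord (m : ms_lim) : forall i, S i := set_val m.

Definition chart_family := forall i, chart (S i) (E i).

Definition lim_dom (c : chart_family) : set ms_lim :=
  [set m | forall i, cdom (c i) (lim_coord m i)].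

(* Projective systems of charts whose limit is a chart of the limit manifold. *)
Definition is_chart_system (c : chart_family) : Prop :=
  [/\ forall i, manifold_chart (c i),
      forall i j (h : (i <= j)%N) x, cdom (c j) x ->
        cdom (c i) (ms_map S h x) /\ c i (ms_map S h x) = bs_map E h (c j x),
      open (lim_dom c)
    & open [set u : F | exists2 m, lim_dom c m &
        forall i, subprod_coord u i = c i (lim_coord m i)]].

Definition has_lim_charts : Prop :=
  forall m : ms_lim, exists2 c, is_chart_system c & lim_dom c m.

(* The total functions [cmap] and [cinv] of a limit chart are pinned down only
   where they are meaningful. *)
Definition ms_lim_atlas : set (chart ms_lim F) :=
  [set C | exists2 c, is_chart_system c & cdom C = lim_dom c /\
    forall m, lim_dom c m ->
      forall i, subprod_coord (C m) i = c i (lim_coord m i)].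

Definition H2_coord (B : H2 E) (i : nat) : contbil (E i) (E i) :=
  subprod_coord B i.

Definition lim_christoffel_class (m : ms_lim) (c : chart_family) (B : H2 E) :
    set (chart_family * H2 E) :=
  [set t | [/\ is_chart_system t.1, lim_dom t.1 m
    & forall i, christoffel_equiv (lim_coord m i) (c i, H2_coord B i)
                  (t.1 i, H2_coord t.2 i)]].

Record lim_christoffel := LimChristoffel {
  lchr_pt : ms_lim;
  lchr_class : set (chart_family * H2 E);
  lchr_classP : exists c B, [/\ is_chart_system c, lim_dom c lchr_pt
    & lchr_class = lim_christoffel_class lchr_pt c B] }.

Definition is_lim_christoffel (g : lim_christoffel) (m : ms_lim)
    (c : chart_family) (B : H2 E) : Prop :=
  lchr_pt g = m /\ lchr_class g = lim_christoffel_class m c B.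

HB.instance Definition _ := gen_eqMixin lim_christoffel.
HB.instance Definition _ := gen_choiceMixin lim_christoffel.

(* (u, B) is the local representative of g in the chart system c, that is
   g = [U, phi, B] with u = phi m. *)
Definition christoffel_coord (c : chart_family) (g : lim_christoffel)
    (z : (F * H2 E)%type) : Prop :=
  [/\ lim_dom c (lchr_pt g),
      forall i, subprod_coord z.1 i = c i (lim_coord (lchr_pt g) i)
    & lchr_class g = lim_christoffel_class (lchr_pt g) c z.2].

Lemma christoffel_coord_inj c g g' z :
  christoffel_coord c g z -> christoffel_coord c g' z -> g = g'.
Proof.
case: g => n K KP; case: g' => n' K' KP' [/= nc zn eK] [/= nc' zn' eK'].
have nn' : n = n'.
  apply: val_inj; apply: functional_extensionality_dep => i.
  change (lim_coord n i = lim_coord n' i).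
  by rewrite -(cmapK (nc i)) -(cmapK (nc' i)) -zn -zn'.
subst n' K K'; congr LimChristoffel; exact: Prop_irrelevance.
Qed.

(* The topology for which [U, phi, B] |-> (phi m, B) are charts: a set is open
   when its image in every chart is. *)
Definition christoffel_open (O : set lim_christoffel) : Prop :=
  forall c, is_chart_system c ->
    open [set z : (F * H2 E)%type | exists2 g, O g & christoffel_coord c g z].

Fact christoffel_openT : christoffel_open setT.
Proof.
move=> c cS; have [_ _ _ cU] := cS.
rewrite (_ : mkset _ = (@fst F (H2 E)) @^-1`
    [set u : F | exists2 m, lim_dom c m &
      forall i, subprod_coord u i = c i (lim_coord m i)]).
  by apply: open_comp => // z _; exact: cvg_fst.
apply/seteqP; split => [z [g _ [gc zg _]]|z [m mc zm]].
  by exists (lchr_pt g).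
have gP : exists c' B, [/\ is_chart_system c', lim_dom c' m
    & lim_christoffel_class m c z.2 = lim_christoffel_class m c' B].
  by exists c, z.2.
by exists (LimChristoffel gP).
Qed.

Fact christoffel_openI : setI_closed christoffel_open.
Proof.
move=> A B oA oB c cS; have := openI (oA c cS) (oB c cS).
congr open; apply/seteqP; split => [z [[g Ag gz] [g' Bg' gz']]|].
  by exists g => //; split => //; rewrite (christoffel_coord_inj gz gz').
by move=> z [g [Ag Bg] gz]; split; exists g.
Qed.

Fact christoffel_open_bigcup (I : Type) (f : I -> set lim_christoffel) :
  (forall i, christoffel_open (f i)) -> christoffel_open (\bigcup_i f i).
Proof.
move=> fo c cS; have := bigcup_open (fun i (_ : setT i) => fo i c cS).
congr open; apply/seteqP; split => [z [i _ [g fg gz]]|z [g [i _ fg] gz]].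
  by exists g => //; exists i.
by exists i => //; exists g.
Qed.

HB.instance Definition _ := isOpenTopological.Build lim_christoffel
  christoffel_openT christoffel_openI christoffel_open_bigcup.

Definition lim_christoffel_atlas :
    set (chart lim_christoffel (F * H2 E)%type) :=
  [set C | exists2 c, is_chart_system c &
    cdom C = [set g | lim_dom c (lchr_pt g)] /\
    forall g, lim_dom c (lchr_pt g) -> christoffel_coord c g (C g)].

(* The projective limit of the CM_i, as a set of sequences. *)
Definition christoffel_lim : set (forall i, christoffel (S i)) :=
  [set gam | exists (m : ms_lim) (c : chart_family)
      (B : forall i, contbil (E i) (E i)),
    [/\ is_chart_system c, lim_dom c m, H2_set B
      & forall i, is_christoffel (gam i) (lim_coord m i) (c i) (B i)]].

(* CM = lim CM_i : the identification [U, phi, B] |-> ([U_i, phi_i, B_i])_i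
   exists. *)
Definition christoffel_lim_exists : Prop :=
  exists Theta : lim_christoffel -> forall i, christoffel (S i),
    set_bij setT christoffel_lim Theta /\
    forall g m c B, is_chart_system c -> lim_dom c m ->
      is_lim_christoffel g m c B ->
      forall i, is_christoffel (Theta g i) (lim_coord m i) (c i) (H2_coord B i).

End limit_manifold.

Arguments ms_lim_atlas {R} S _.
Arguments lim_christoffel_atlas {R} S _.
Arguments lchr_pt {R S} l.

(* Main.v *)
Require Import Defs.
From mathcomp Require Import all_boot all_order all_algebra.
From mathcomp Require Import all_classical all_reals all_analysis.
From HB Require Import structures.
From mathcomp Require Import ring.

(** The space CM of Christoffel elements of a limit manifold M is a bundle
    because every question about it is decided in one Banach factor at a time.

    Fix two chart systems c, d at a point m = (m_i), and let F_i be the change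
    of charts from c_i to d_i, u_i = c_i(m_i). Two triples are equivalent
    exactly when B'_i is the image of B_i under
      B |-> (x, y) |-> DF_i(u_i) B(Ax, Ay) + D^2F_i(u_i)(Ax, Ay),
    A being the inverse of DF_i(u_i) ([christoffel_equivP]). This law is a
    cocycle, by the chain rules of orders one and two
    ([christoffel_tr_comp]), and it commutes with the connecting maps, because
    these intertwine F_j and F_i ([christoffel_tr_natural]). Hence it preserves
    coherent sequences of bilinear maps, and over the domain of c each
    Christoffel element has one and only one representative (u, B): the fibre
    is H^2(F, F), and [U, phi, B] |-> (m, B) trivializes CM over the domain
    of c.

    It remains to see that all the maps in question are smooth. In charts, the
    i-th component of each of them depends on the i-th component of its
    argument alone, through a smooth map between Banach spaces; a map with
    this property into a projective limit is smooth in the sense of Michal and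
    Bastiani ([frechet_smooth_proj]), since its difference quotients converge
    in each factor and coherent sequences form a closed subspace. Changes of
    charts of CM, the trivializations and their inverses all have one common
    local form, treated once in [smooth_to_christoffel].

    The Banach calculus behind this rests on one statement, the product rule
    for bounded bilinear maps ([banach_Ck_bilin]): evaluation, composition and
    pull-back of operators are bounded bilinear, so that the chain rule and the
    smoothness of the transformation law in (u, B) follow from it. The
    topology of CM is the one defined by its charts; that the charts are
    homeomorphisms is again the continuity of the transformation law. *)

Set Implicit Arguments.
Unset Strict Implicit.
Unset Printing Implicit Defensive.

Import Order.TTheory GRing.Theory Num.Theory.
Import numFieldNormedType.Exports.

Local Open Scope classical_set_scope.
Local Open Scope ring_scope.

(** * Bounded linear and bilinear maps *)

Section bounded_maps.
Context {R : realType}.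
Implicit Types (U V W X : normedModType R).

Definition bounded_linear V W (f : V -> W) :=
  linear f /\ exists C : R, forall x, `|f x| <= C * `|x|.

Definition bounded_bilinear U V W (b : U -> V -> W) :=
  [/\ forall v, linear (b^~ v), forall u, linear (b u) &
      exists2 C : R, 0 <= C & forall u v, `|b u v| <= C * `|u| * `|v|].

Lemma bounded_linear_map_continuous V W (f : V -> W) :
  bounded_linear f -> continuous f.
Proof.
move=> [fL [C fC]].
pose fl : {linear V -> W} := HB.pack f (GRing.isLinear.Build _ _ _ _ _ fL).
suff : continuous fl by [].
apply/linear_bounded_continuous/linear_boundedP.
exists `|C|; split=> // M CM x; apply: le_trans (fC x) _.
by rewrite ler_wpM2r// (le_trans (ler_norm C))// ltW.
Qed.

Lemma bounded_linear_contlin V W (f : V -> W) :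
  bounded_linear f -> contlin_set f.
Proof. by move=> fB; split; [case: fB|exact: bounded_linear_map_continuous]. Qed.

Lemma bounded_bilinear_continuous U V W (b : U -> V -> W) :
  bounded_bilinear b -> continuous (fun p : U * V => b p.1 p.2).
Proof.
move=> [bl br [C C0 bC]] [u v]; apply/cvgrPdist_le => /= e e0.
(* |b(u,v) - b(p)| <= C (|u - p.1| |p.2| + |u| |v - p.2|), where
   |p.2| <= |v| + 1 near v. *)
pose K := C * (`|u| + `|v| + 1) + 1.
have K0 : 0 < K by rewrite /K ltr_wpDl// mulr_ge0// !addr_ge0.
have d0 : 0 < Num.min 1 (e / K) by rewrite lt_min ltr01 divr_gt0.
have bB w (x y : V) : b w (x - y) = b w x - b w y.
  by rewrite -[x - y]addrC -scaleN1r br scaleN1r addrC.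
have bB' w (x y : U) : b (x - y) w = b x w - b y w.
  by rewrite -[x - y]addrC -scaleN1r bl scaleN1r addrC.
have nb := @nbhsx_ballx R (U * V)%type (u, v) _ d0.
near=> p; have : ball (u, v) (Num.min 1 (e / K)) p.
  by near: p; exact: nb.
rewrite -ball_normE /ball_/= prod_normE/= gt_max => /andP[up vp].
rewrite (_ : b u v - b p.1 p.2 = b (u - p.1) p.2 + b u (v - p.2)); last first.
  by rewrite bB bB' [RHS]addrC addrA subrK.
apply: le_trans (ler_normD _ _) _.
have p2 : `|p.2| <= `|v| + 1.
  rewrite -[p.2](subKr v); apply: le_trans (ler_normB _ _) _.
  by rewrite lerD2l; apply/ltW/(lt_le_trans vp); rewrite ge_min lexx.
have [u1 v1] : `|u - p.1| <= e / K /\ `|v - p.2| <= e / K.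
  by split; apply/ltW; [apply: (lt_le_trans up)|apply: (lt_le_trans vp)];
    rewrite ge_min lexx orbT.
apply: (@le_trans _ _ (C * (e / K) * (`|v| + 1) + C * `|u| * (e / K))).
  apply: lerD; first apply: le_trans (bC _ _) _.
    by rewrite ler_pM ?mulr_ge0// ler_wpM2l.
  by apply: le_trans (bC _ _) _; rewrite ler_wpM2l// mulr_ge0.
rewrite (_ : _ + _ = (C * (`|u| + `|v| + 1)) * e / K); last first.
  by rewrite -!mulrA; ring.
by rewrite ler_pdivrMr// mulrC ler_pM2l// /K lerDl.
Unshelve. all: by end_near. Qed.

End bounded_maps.

(** * Differentials and operator norms *)

Section differential.
Context {R : realType}.
Implicit Types (U V W X : normedModType R).

(** In this epsilon form it is apparent that differentiability and the
    differential depend on f only near x, see [near_eq_diff]. *)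
Lemma has_diffP V W (f : V -> W) x (L : {linear V -> W}) :
  differentiable f x /\ 'd f x = L :> (V -> W) <->
  continuous L /\ forall e, 0 < e ->
    \forall y \near x, `|f y - f x - L (y - x)| <= e * `|y - x|.
Proof.
have shiftE (df : {linear V -> W}) :
    f \o shift x = cst (f x) + df +o_ 0 id <->
    forall e, 0 < e ->
    \forall y \near x, `|f y - f x - df (y - x)| <= e * `|y - x|.
  split=> [/eqaddoP fo e e0|fe].
    apply/nbhs0P; near=> h; rewrite /= [x + h - x]addrC addKr.
    have -> : f (x + h) - f x - df h = (f \o shift x - (cst (f x) + df)) h.
      by rewrite /= [x + h]addrC -addrA -opprD.
    by near: h; exact: fo.
  apply/eqaddoP => e e0; have /nbhs0P := fe e e0.
  apply: filterS => h /=; rewrite [x + h - x]addrC addKr.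
  suff -> : f (x + h) - f x - df h = (f \o shift x - (cst (f x) + df)) h by [].
  by rewrite /= [x + h]addrC -addrA -opprD.
split=> [[fx <-]|[Lc /shiftE fL]].
  split; first exact: diff_continuous.
  by apply/shiftE; exact: diff_locally.
have dL := diff_unique Lc fL.
split; last exact: dL.
by apply/diff_locallyP; rewrite dL.
Unshelve. all: by end_near. Qed.

Lemma near_eq_diff V W (f g : V -> W) x :
  (\forall y \near x, f y = g y) -> differentiable f x ->
  differentiable g x /\ 'd g x = 'd f x :> (V -> W).
Proof.
move=> fg df; have [dc de] := (has_diffP f x ('d f x)).1 (conj df erefl).
apply/has_diffP; split=> // e e0; near=> y.
rewrite -(nbhs_singleton fg) -(near fg y)//.
by near: y; exact: de.
Unshelve. all: by end_near. Qed.

Lemma diff_bounded_linear V W (f : V -> W) x : bounded_linear f ->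
  differentiable f x /\ 'd f x = f :> (V -> W).
Proof.
move=> fB; have fC := bounded_linear_map_continuous fB; have [fL _] := fB.
pose fl : {linear V -> W} := HB.pack f (GRing.isLinear.Build _ _ _ _ _ fL).
split; first exact: (@linear_differentiable _ _ _ fl).
exact: (@diff_lin _ _ _ fl).
Qed.

Lemma diff_bounded_bilinear X U V W (b : U -> V -> W) (f : X -> U) (g : X -> V)
    (x : X) : bounded_bilinear b -> differentiable f x -> differentiable g x ->
  differentiable (fun y => b (f y) (g y)) x /\
  'd (fun y => b (f y) (g y)) x =
    (fun v => b (f x) ('d g x v) + b ('d f x v) (g x)) :> (X -> W).
Proof.
move=> bB df dg; have bC := bounded_bilinear_continuous bB.
have [bl br _] := bB.
have bL : bilinear_for (GRing.Scale.Law.clone _ _ *:%R _)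
    (GRing.Scale.Law.clone _ _ *:%R _) b.
  by split=> [v|u] a y z; [exact: bl|exact: br].
pose bm : {bilinear U -> V -> W} :=
  HB.pack b (bilinear_isBilinear.Build _ _ _ _ _ _ _ bL).
have dfg := differentiable_pair df dg.
have db := @differentiable_bilin _ _ _ _ bm (f x, g x) bC.
split; first exact: (differentiable_comp dfg db).
apply: etrans (diff_comp dfg db) _.
by rewrite (diff_pair df dg) (@diff_bilin _ _ _ _ bm).
Qed.

End differential.

Section operators.
Context {R : realType}.
Implicit Types (U V W X : normedModType R).

Lemma contlin_linear V W (A : contlin V W) : linear A.
Proof. by have [] := opfunP A. Qed.

Lemma contlin_linearD V W (A : contlin V W) : {morph A : x y / x + y}.
Proof.
by move=> x y; have := contlin_linear A 1 x y; rewrite !scale1r.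
Qed.

Lemma contlin_le V W (A : contlin V W) x : `|A x| <= `|A| * `|x|.
Proof.
have [->|x0] := eqVneq x 0.
  by rewrite (linear_fun0 (@contlin_linear _ _ A)) !normr0 mulr0.
have nx : 0 < `|x| by rewrite normr_gt0.
have : `|A (`|x|^-1 *: x)| <= `|A|.
  by apply: (@opnorm_ub _ _ _ _ A); rewrite /= normrZ normfV normr_id mulVf ?gt_eqF.
rewrite (linear_funZ (@contlin_linear _ _ A)) normrZ normfV normr_id.
by rewrite ler_pdivrMl// mulrC.
Qed.

Lemma contlin_norm_le V W (A : contlin V W) (K : R) : 0 <= K ->
  (forall x, `|A x| <= K * `|x|) -> `|A| <= K.
Proof.
move=> K0 AK; apply: (@opnorm_le _ _ _ _ A) => x /= x1.
by apply: le_trans (AK x) _; rewrite ler_piMr.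
Qed.

Lemma contbil_le V W (B : contbil V W) x y : `|B (x, y)| <= `|B| * `|x| * `|y|.
Proof.
have [Bl Br _] := opfunP B.
have [->|x0] := eqVneq x 0.
  by rewrite (linear_fun0 (Bl y)) !normr0 mulr0 mul0r.
have [->|y0] := eqVneq y 0.
  by rewrite (linear_fun0 (Br x)) !normr0 mulr0.
have nx : 0 < `|x| by rewrite normr_gt0.
have ny : 0 < `|y| by rewrite normr_gt0.
have : `|B (`|x|^-1 *: x, `|y|^-1 *: y)| <= `|B|.
  apply: (@opnorm_ub _ _ _ _ B); rewrite /= prod_normE/= !normrZ !normfV.
  by rewrite !normr_id !mulVf ?gt_eqF// maxxx.
rewrite (linear_funZ (Bl _)) (linear_funZ (Br _)) !normrZ !normfV !normr_id.
by rewrite ler_pdivrMl// ler_pdivrMl// mulrC [`|x| * _]mulrC.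
Qed.

Lemma contbil_norm_le V W (B : contbil V W) (K : R) : 0 <= K ->
  (forall x y, `|B (x, y)| <= K * `|x| * `|y|) -> `|B| <= K.
Proof.
move=> K0 BK; apply: (@opnorm_le _ _ _ _ B) => -[x y] /=.
rewrite prod_normE/= ge_max => /andP[x1 y1].
apply: le_trans (BK x y) _; rewrite -mulrA ler_piMr//.
by rewrite -[leRHS]mulr1 ler_pM.
Qed.

Lemma contbilP V W (B : contbil V W) : bounded_bilinear (fun x y => B (x, y)).
Proof.
have [Bl Br _] := opfunP B.
by split=> //; exists `|B| => // u v; exact: contbil_le.
Qed.

Lemma bounded_bilinear_contbil V W (b : V -> V -> W) :
  bounded_bilinear b -> contbil_set (fun p : V * V => b p.1 p.2).
Proof.
by move=> bB; have [bl br _] := bB; split=> //; exact: bounded_bilinear_continuous.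
Qed.

(** The value 0 on maps that are not continuous linear makes the constructor
    total: an operator can be written down first and identified under the
    bounds proved later. *)
Definition to_contlin V W (f : V -> W) : contlin V W :=
  if pselect (contlin_set f) is left fP then OpType (fP : op_set (contlin_space V W) f)
  else 0.

Definition to_contbil V W (f : V * V -> W) : contbil V W :=
  if pselect (contbil_set f) is left fP then OpType (fP : op_set (contbil_space V W) f)
  else 0.

Lemma to_contlinE V W (f : V -> W) : bounded_linear f ->
  to_contlin f = f :> (V -> W).
Proof.
by move=> /bounded_linear_contlin fP; rewrite /to_contlin; case: pselect.
Qed.

Lemma to_contbilE V W (b : V -> V -> W) : bounded_bilinear b ->
  forall x y, to_contbil (fun p => b p.1 p.2) (x, y) = b x y.
Proof.
by move=> /bounded_bilinear_contbil fP x y; rewrite /to_contbil; case: pselect.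
Qed.

End operators.

(** * Calculus of C^k maps between normed spaces *)

Section banach_Ck_theory.
Context {R : realType}.
Implicit Types (U V W X : normedModType R).

(** The derivative of f as a map into the space of operators, so that
    [Dmap (Dmap f)] is the second derivative. *)
Definition Dmap V W (f : V -> W) (x : V) : contlin V W := to_contlin ('d f x).

Lemma DmapE V W (f : V -> W) x : differentiable f x ->
  Dmap f x = 'd f x :> (V -> W).
Proof.
move=> df; apply: to_contlinE; split; first exact: linearP.
by have [k _ fk] := linear_lipschitz (diff_continuous df); exists k.
Qed.

Lemma Dmap_eq V W (f : V -> W) x (A : contlin V W) :
  differentiable f x -> 'd f x = A :> (V -> W) -> Dmap f x = A.
Proof. by move=> df dA; apply: optype_ext => v; rewrite DmapE// dA. Qed.

Lemma near_eq_Dmap V W (f g : V -> W) x :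
  (\forall y \near x, f y = g y) -> differentiable f x -> Dmap g x = Dmap f x.
Proof.
move=> fg df; have [dg gE] := near_eq_diff fg df.
by apply: (Dmap_eq dg); rewrite gE DmapE.
Qed.

Lemma open_near_eq (T : topologicalType) (Y : Type) (D : set T) (f g : T -> Y) x :
  open D -> (forall y, D y -> f y = g y) -> D x -> \forall y \near x, f y = g y.
Proof.
by move=> oD fg Dx; apply: filterS fg _; exact: open_nbhs_nbhs.
Qed.

Lemma banach_Ck_eq k V W (D D' : set V) (f g : V -> W) :
  open D -> open D' -> D' `<=` D -> (forall x, D' x -> f x = g x) ->
  banach_Ck k D f -> banach_Ck k D' g.
Proof.
elim: k W f g => [|k IH] W f g oD oD' D'D fg /=.
  rewrite !continuous_open_subspace// => fC x /[!inE] D'x.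
  have fx : {for x, continuous f} by apply: fC; rewrite inE; exact: D'D.
  rewrite /continuous_at -fg//; apply: cvg_trans fx.
  by apply: near_eq_cvg; exact: (open_near_eq oD' fg).
move=> [Df [fD DfC]]; exists Df; split; last exact: IH DfC.
move=> x D'x; have [df dfE] := fD x (D'D _ D'x).
have [dg dgE] := near_eq_diff (open_near_eq oD' fg D'x) df.
by split=> [|v]; [exact: dg|rewrite dgE].
Qed.

(** The derivative in the definition of C^k maps is only asked to exist; on an
    open set it must agree with [Dmap f], which makes all later inductions on
    the order possible without carrying a witness. *)
Lemma banach_CkS k V W (D : set V) (f : V -> W) : open D ->
  banach_Ck k.+1 D f <->
  (forall x, D x -> differentiable f x) /\ banach_Ck k D (Dmap f).
Proof.
move=> oD; split=> [[Df [fD DfC]]|[fD fC]].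
  split=> [x /fD[]//|]; apply: banach_Ck_eq DfC => // x Dx.
  by have [df dE] := fD x Dx; apply/esym/(Dmap_eq df)/funext.
by exists (Dmap f); split=> // x /fD df; split=> // v; rewrite DmapE.
Qed.

Lemma banach_Ck_cont k V W (D : set V) (f : V -> W) : open D ->
  banach_Ck k D f -> {within D, continuous f}.
Proof.
move=> oD; case: k => [//|k /= [Df [fD _]]].
rewrite continuous_open_subspace// => x /[!inE] /fD[df _].
exact: differentiable_continuous.
Qed.

Lemma banach_CkW k V W (D : set V) (f : V -> W) : open D ->
  banach_Ck k.+1 D f -> banach_Ck k D f.
Proof.
move=> oD; elim: k W f => [|k IH] W f; first exact: banach_Ck_cont.
move=> [Df [fD DfC]]; exists Df; split=> //; exact: IH.
Qed.

Lemma banach_Ck_local k V W (D : set V) (f : V -> W) : open D ->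
  (forall x, D x -> exists D', [/\ open D', D' x & banach_Ck k D' f]) ->
  banach_Ck k D f.
Proof.
move=> oD; elim: k W f => [|k IH] W f fD.
  rewrite /= continuous_open_subspace// => x /[!inE] /fD[D' [oD' D'x]].
  by rewrite /= continuous_open_subspace//; apply; rewrite inE.
apply/(banach_CkS _ _ oD); split=> [x /fD[D' [oD' D'x]]|].
  by move=> /(banach_CkS _ _ oD')[+ _]; exact.
apply: IH => x /fD[D' [oD' D'x]] /(banach_CkS _ _ oD')[_ fC].
by exists D'.
Qed.

Lemma banach_Ck_cst k V W (D : set V) (w : W) : open D ->
  banach_Ck k D (cst w).
Proof.
move=> oD; elim: k W w => [|k IH] W w.
  by rewrite /= continuous_open_subspace// => x _; exact: cvg_cst.
apply/(banach_CkS _ _ oD); split=> [x _|]; first exact: differentiable_cst.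
apply: banach_Ck_eq (IH _ 0) => // x _; apply/esym/Dmap_eq.
  exact: differentiable_cst.
by rewrite diff_cst.
Qed.

Lemma banach_Ck_linear k V W (D : set V) (f : V -> W) : open D ->
  bounded_linear f -> banach_Ck k D f.
Proof.
move=> oD fB; case: k => [|k].
  rewrite /= continuous_open_subspace// => x _.
  exact: bounded_linear_map_continuous.
apply/(banach_CkS _ _ oD); split=> [x _|]; first by have [] := diff_bounded_linear x fB.
apply: banach_Ck_eq (banach_Ck_cst k (to_contlin f) oD) => // x _.
have [df dE] := diff_bounded_linear x fB.
by apply/esym/(Dmap_eq df); rewrite dE to_contlinE.
Qed.

Lemma banach_CkD k V W (D : set V) (f g : V -> W) : open D ->
  banach_Ck k D f -> banach_Ck k D g -> banach_Ck k D (fun x => f x + g x).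
Proof.
move=> oD; elim: k W f g => [|k IH] W f g.
  rewrite /= !continuous_open_subspace// => fC gC x xD.
  by apply: cvgD; [exact: fC|exact: gC].
move=> /(banach_CkS _ _ oD)[df fC] /(banach_CkS _ _ oD)[dg gC].
apply/(banach_CkS _ _ oD); split=> [x Dx|].
  by apply: (@differentiableD _ _ _ f g); [exact: df|exact: dg].
apply: banach_Ck_eq (IH _ _ _ fC gC) => // x Dx; apply/esym/Dmap_eq.
  by apply: (@differentiableD _ _ _ f g); [exact: df|exact: dg].
apply: etrans (diffD (df _ Dx) (dg _ Dx)) _.
by apply/funext => v; rewrite -(DmapE (df _ Dx)) -(DmapE (dg _ Dx)).
Qed.

Section bilinear_operators.
Context (X U V W : normedModType R) (b : U -> V -> W).
Hypothesis bB : bounded_bilinear b.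

(** The two halves of the derivative of b(f, g): [bilin_l (Df x) (g x)] and
    [bilin_r (f x) (Dg x)]. *)
Definition bilin_l (A : contlin X U) (v : V) : contlin X W :=
  to_contlin (fun x => b (A x) v).
Definition bilin_r (u : U) (A : contlin X V) : contlin X W :=
  to_contlin (fun x => b u (A x)).

Lemma bilin_lE A v x : bilin_l A v x = b (A x) v.
Proof.
have [bl br [C C0 bC]] := bB.
rewrite /bilin_l to_contlinE//; split.
  by move=> a y z; rewrite contlin_linear bl.
exists (C * `|A| * `|v|) => y; apply: le_trans (bC _ _) _.
rewrite -[leRHS]mulrA [`|v| * _]mulrC mulrA ler_wpM2r// -mulrA ler_wpM2l//.
exact: contlin_le.
Qed.

Lemma bilin_rE u A x : bilin_r u A x = b u (A x).
Proof.
have [bl br [C C0 bC]] := bB.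
rewrite /bilin_r to_contlinE//; split.
  by move=> a y z; rewrite contlin_linear br.
exists (C * `|u| * `|A|) => y; apply: le_trans (bC _ _) _.
by rewrite -[leRHS]mulrA ler_wpM2l ?mulr_ge0// contlin_le.
Qed.

Lemma bilin_l_bounded : bounded_bilinear bilin_l.
Proof.
have [bl br [C C0 bC]] := bB; split.
- by move=> v a A B; apply: optype_ext => x; rewrite /= !bilin_lE/= bl.
- by move=> A a v w; apply: optype_ext => x; rewrite /= !bilin_lE/= br.
exists C => // A v; apply: contlin_norm_le => [|x]; first by rewrite !mulr_ge0.
rewrite bilin_lE; apply: le_trans (bC _ _) _.
rewrite -[leRHS]mulrA [`|v| * _]mulrC mulrA ler_wpM2r// -mulrA ler_wpM2l//.
exact: contlin_le.
Qed.

Lemma bilin_r_bounded : bounded_bilinear bilin_r.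
Proof.
have [bl br [C C0 bC]] := bB; split.
- by move=> v a A B; apply: optype_ext => x; rewrite /= !bilin_rE/= bl.
- by move=> A a v w; apply: optype_ext => x; rewrite /= !bilin_rE/= br.
exists C => // u A; apply: contlin_norm_le => [|x]; first by rewrite !mulr_ge0.
rewrite bilin_rE; apply: le_trans (bC _ _) _.
by rewrite -[leRHS]mulrA ler_wpM2l ?mulr_ge0// contlin_le.
Qed.

End bilinear_operators.

(** Product rule. The derivative of b(f, g) is the sum of two maps of the same
    shape, built from (f, Df, g, Dg) by the bounded bilinear maps [bilin_l] and
    [bilin_r]; quantifying over b and over all the spaces, the induction on k
    closes. *)
Lemma banach_Ck_bilin k X U V W (b : U -> V -> W) (D : set X) f g : open D ->
  bounded_bilinear b -> banach_Ck k D f -> banach_Ck k D g ->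
  banach_Ck k D (fun x => b (f x) (g x)).
Proof.
move=> oD; elim: k U V W b f g => [|k IH] U V W b f g bB.
  rewrite /= !continuous_open_subspace// => fC gC x xD.
  have bc := bounded_bilinear_continuous bB.
  apply: (@continuous2_cvg _ _ _ _ _ _ f g b _ _ (bc (f x, g x))).
    exact: fC.
  exact: gC.
move=> fS gS; have fW := banach_CkW oD fS; have gW := banach_CkW oD gS.
move: fS gS => /(banach_CkS _ _ oD)[df fC] /(banach_CkS _ _ oD)[dg gC].
apply/(banach_CkS _ _ oD); split=> [x Dx|].
  by have [] := diff_bounded_bilinear bB (df x Dx) (dg x Dx).
apply: banach_Ck_eq (banach_CkD oD (IH _ _ _ _ _ _ (bilin_r_bounded X bB) fW gC)
  (IH _ _ _ _ _ _ (bilin_l_bounded X bB) fC gW)) => // x Dx.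
have [d dE] := diff_bounded_bilinear bB (df x Dx) (dg x Dx).
apply/esym/(Dmap_eq d); rewrite dE; apply/funext => v /=.
by rewrite bilin_lE// bilin_rE// !DmapE//; [exact: df|exact: dg].
Qed.

Lemma contlin_eval_bounded V W :
  bounded_bilinear (fun (A : contlin V W) (x : V) => A x).
Proof.
split=> [v a A B //|A|]; first exact: contlin_linear.
by exists 1 => // A x; rewrite mul1r; exact: contlin_le.
Qed.

(** The derivative of a composite is the composition of operators, a bounded
    bilinear expression in (Dg o f, Df): the chain rule is an instance of the
    product rule. *)
Lemma banach_Ck_comp k U V W (D : set U) (D' : set V) (f : U -> V) (g : V -> W) :
  open D -> open D' -> (forall x, D x -> D' (f x)) ->
  banach_Ck k D f -> banach_Ck k D' g -> banach_Ck k D (g \o f).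
Proof.
move=> oD oD' DD'; elim: k W g => [|k IH] W g.
  rewrite /= !continuous_open_subspace// => fC gC x xD.
  apply: continuous_comp; first exact: fC.
  by apply: gC; rewrite inE; apply: DD'; rewrite -inE.
move=> fS; have fW := banach_CkW oD fS.
move: fS => /(banach_CkS _ _ oD)[df fC] /(banach_CkS _ _ oD')[dg gC].
have dgf x : D x -> differentiable (g \o f) x.
  move=> Dx; apply: differentiable_comp; first exact: df.
  exact/dg/DD'.
apply/(banach_CkS _ _ oD); split=> //.
have eB := contlin_eval_bounded V W.
apply: banach_Ck_eq (banach_Ck_bilin oD (bilin_r_bounded U eB) (IH _ _ fW gC) fC)
   => // x Dx.
apply/esym/(Dmap_eq (dgf x Dx)); apply/funext => v.
rewrite bilin_rE// diff_comp//; [|exact: df|exact/dg/DD'].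
by rewrite /= !DmapE//; [exact: df|exact/dg/DD'].
Qed.

End banach_Ck_theory.

(** * From Banach smoothness to smoothness into a projective limit *)

Section frechet_Ck_theory.
Context {R : realType}.

Lemma linear_quotient (V W : lmodType R) (f : V -> W) (a : R) x y : linear f ->
  f (a *: (x - y)) = a *: (f x - f y).
Proof.
move=> fL; pose fl : {linear V -> W} := HB.pack f (GRing.isLinear.Build _ _ _ _ _ fL).
by rewrite -[f]/(fl : V -> W) linearZ linearB.
Qed.

Lemma frechet_Ck_cont k (V W : tvsType R) (D : set V) (f : V -> W) :
  frechet_Ck k D f -> {within D, continuous f}.
Proof. by case: k => [|k] []. Qed.

Lemma within_open_eq (V W : topologicalType) (D D' : set V) (f g : V -> W) :
  open D -> open D' -> D' `<=` D -> (forall x, D' x -> f x = g x) ->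
  {within D, continuous f} -> {within D', continuous g}.
Proof.
move=> oD oD' D'D fg; rewrite !continuous_open_subspace// => fC x /[!inE] D'x.
have fx : {for x, continuous f} by apply: fC; rewrite inE; exact: D'D.
rewrite /continuous_at -fg//; apply: cvg_trans fx.
by apply: near_eq_cvg; exact: (open_near_eq oD' fg).
Qed.

Lemma cvg_line (V : tvsType R) (x v : V) :
  (fun h : R => x + h *: v) @ (0 : R) --> x.
Proof.
rewrite -[X in _ --> X]addr0 -[X in _ --> x + X](scale0r v).
have := @add_continuous V (x, 0 *: v).
move=> /(@continuous2_cvg R _ _ _ _ _ (fun=> x) (fun h => h *: v) _ _ _) addc.
apply: addc; first exact: cvg_cst.
have := @scale_continuous R V (0, v).
move=> /(@continuous2_cvg R _ _ _ _ _ id (fun=> v) _ _ _); apply.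
  exact: cvg_id.
exact: cvg_cst.
Qed.

Lemma frechet_Ck_eq k (V W : tvsType R) (D D' : set V) (f g : V -> W) :
  open D -> open D' -> D' `<=` D -> (forall x, D' x -> f x = g x) ->
  frechet_Ck k D f -> frechet_Ck k D' g.
Proof.
elim: k V D D' f g => [|k IH] V D D' f g oD oD' D'D fg /= [fC fS].
  by split=> //; exact: within_open_eq fC.
split; first exact: within_open_eq fC.
have [df [fl dfC]] := fS; exists df; split.
  move=> x v D'x; apply: cvg_trans (fl x v (D'D _ D'x)).
  apply: near_eq_cvg; apply: cvg_within.
  have /(cvg_line v) : nbhs x D' by exact: open_nbhs_nbhs.
  apply: (@filterS _ (nbhs (0 : R)) _ (fun h => D' (x + h *: v))) => h D'h.
  by rewrite !fg.
apply: IH dfC => //; [exact: open_cylinder|exact: open_cylinder|].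
by move=> [x v] [/= /D'D].
Qed.

Lemma frechet_Ck_precomp k (V V' W : tvsType R) (D : set V) (f : V -> W)
    (L : V' -> V) : open D -> linear L -> continuous L ->
  frechet_Ck k D f -> frechet_Ck k (L @^-1` D) (f \o L).
Proof.
elim: k V V' D f L => [|k IH] V V' D f L oD lL cL /= [fC fS].
  split=> //.
  have oLD : open (L @^-1` D) by apply: open_comp.
  move: fC; rewrite !continuous_open_subspace// => fC x /[!inE] Dx.
  by apply: continuous_comp; [exact: cL|apply: fC; rewrite inE].
split.
  have oLD : open (L @^-1` D) by apply: open_comp.
  move: fC; rewrite !continuous_open_subspace// => fC x /[!inE] Dx.
  by apply: continuous_comp; [exact: cL|apply: fC; rewrite inE].
have [df [fl dfC]] := fS.
pose L2 (p : (V' * V')%type) := (L p.1, L p.2).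
exists (df \o L2); split.
  move=> x v Dx; have := fl (L x) (L v) Dx.
  rewrite (_ : (fun h : R => _) =
    (fun h : R => h^-1 *: ((f \o L) (x + h *: v) - (f \o L) x)))//.
  by apply/funext => h /=; rewrite [x + _]addrC lL [L x + _]addrC.
have := IH (V * V)%type (V' * V')%type _ _ L2 _ _ _ dfC.
rewrite (_ : _ @^-1` _ = (L @^-1` D) `*` setT)//; apply.
- exact: open_cylinder.
- by move=> a [x y] [z t]; rewrite /L2/= !lL.
- move=> [x y]; apply: cvg_pair.
    by apply: (@cvg_comp _ _ _ fst L); [exact: cvg_fst|exact: cL].
  by apply: (@cvg_comp _ _ _ snd L); [exact: cvg_snd|exact: cL].
Qed.

(** The directional derivative (x, v) |-> Df(x) v is an evaluation, hence as
    smooth as Df, jointly in (x, v); this is where continuity for the operator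
    norm gives the joint continuity asked for in locally convex spaces. *)
Lemma banach_Ck_frechet k (V W : normedModType R) (D : set V) (f : V -> W) :
  open D -> banach_Ck k D f -> frechet_Ck k D f.
Proof.
elim: k V D f => [|k IH] V D f oD; first by move=> /=.
move=> fS; split; first exact: banach_Ck_cont fS.
move: fS => /(banach_CkS _ _ oD)[df fC].
exists (fun p : V * V => Dmap f p.1 p.2); split.
  move=> x v Dx; rewrite DmapE; last exact: df.
  have := @diff_derivable _ _ _ f x v (df x Dx).
  rewrite -(deriveE v (df x Dx)) /derivable /derive.
  rewrite (_ : (fun h : R => h^-1 *: ((f \o shift x) (h *: v) - f x)) =
     (fun h : R => h^-1 *: (f (x + h *: v) - f x))); last first.
    by apply/funext => h /=; rewrite [h *: v + x]addrC.
  exact.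
have oDT : open (D `*` setT : set (V * V)) by exact: open_cylinder.
apply: (IH (V * V)%type) => //.
apply: (banach_Ck_bilin (f := Dmap f \o fst) (g := snd) oDT
  (contlin_eval_bounded V W)).
  apply: (banach_Ck_comp oDT oD _ _ fC); first by move=> p [].
  apply: banach_Ck_linear => //; split; first by move=> a [x y] [z t].
  by exists 1 => x; rewrite mul1r prod_normE/= le_max lexx.
apply: banach_Ck_linear => //; split; first by move=> a [x y] [z t].
by exists 1 => x; rewrite mul1r prod_normE/= le_max lexx orbT.
Qed.

(** What is needed of the projections of a projective limit: they determine
    points and convergence, and coordinatewise limits of a filter are the
    coordinates of a point. The last clause expresses that coherent sequences
    form a closed subspace of the product. *)
Definition projective_family (W : tvsType R) (Y : nat -> normedModType R)
    (q : forall i, W -> Y i) :=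
  [/\ forall i, linear (q i) /\ continuous (q i),
      forall w w', (forall i, q i w = q i w') -> w = w',
      forall (F : set_system W) w, Filter F ->
        (forall i, q i @ F --> q i w) -> F --> w
    & forall (F : set_system W) (y : forall i, Y i), ProperFilter F ->
        (forall i, q i @ F --> y i) -> exists w, forall i, q i w = y i].

(** The coordinates of the difference quotients of f converge to the
    derivatives of the coordinates of f, so that these derivatives are the
    coordinates of a point, which is the derivative of f. *)
Lemma frechet_Ck_proj k (V W : tvsType R) (Y : nat -> normedModType R)
    (q : forall i, W -> Y i) (D : set V) (f : V -> W) : open D ->
  projective_family q ->
  (forall i, frechet_Ck k D (q i \o f)) -> frechet_Ck k D f.
Proof.
move=> + [qlc _ qc qe]; have ql i := (qlc i).1; elim: k V D f => [|k IH] V D f oD fk.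
  split=> //; rewrite continuous_open_subspace// => x Dx.
  apply: qc => i; have := frechet_Ck_cont (fk i).
  by rewrite continuous_open_subspace//; exact.
split.
  rewrite continuous_open_subspace// => x Dx.
  apply: qc => i; have := frechet_Ck_cont (fk i).
  by rewrite continuous_open_subspace//; exact.
have dqX : forall i, exists df : V * V -> Y i,
    (forall x v, D x -> (fun h : R => h^-1 *: (q i (f (x + h *: v)) - q i (f x)))
      @ 0^' --> df (x, v)) /\
    @frechet_Ck R k (V * V)%type (Y i) (D `*` setT) df.
  by move=> i; have [_] := fk i.
pose dq i := projT1 (cid (dqX i)); have dqP i := projT2 (cid (dqX i)).
have quot i x v : q i \o (fun h : R => h^-1 *: (f (x + h *: v) - f x)) =
    (fun h : R => h^-1 *: (q i (f (x + h *: v)) - q i (f x))).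
  by apply/funext => h /=; rewrite (linear_quotient _ _ _ (ql i)).
(* Over points outside D the derivative takes an arbitrary value. *)
have lift p : exists w, D p.1 -> forall i, q i w = dq i p.
  have [Dp|nDp] := pselect (D p.1); last by exists 0.
  pose F := (fun h : R => h^-1 *: (f (p.1 + h *: p.2) - f p.1)) @ 0^'.
  have [w wE] : exists w, forall i, q i w = dq i p.
    apply: (qe F) => i.
    by rewrite -fmap_comp quot; case: p Dp {F} => x v /=; exact: (dqP i).1.
  by exists w.
have [df dfE] := boolp.choice lift.
exists df; split.
  move=> x v Dx; apply: qc => i.
  by rewrite -fmap_comp quot (dfE (x, v))//; exact: (dqP i).1.
have oDT : open (D `*` setT : set (V * V)) by exact: open_cylinder.
apply: (IH (V * V)%type) => // i.
apply: (frechet_Ck_eq oDT oDT _ _ (dqP i).2) => // p [Dp _].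
by rewrite /= dfE.
Qed.

(** The criterion used for every map of the bundle: its i-th component factors
    through the i-th component of the argument by a smooth map g between normed
    spaces. *)
Lemma frechet_smooth_proj (V W : tvsType R) (X Y : nat -> normedModType R)
    (p : forall i, V -> X i) (q : forall i, W -> Y i) (D : set V) (f : V -> W) :
  open D -> (forall i, linear (p i)) -> (forall i, continuous (p i)) ->
  projective_family q ->
  (forall i, exists (O : set (X i)) (g : X i -> Y i),
    [/\ open O, banach_smooth O g
      & forall x, D x -> O (p i x) /\ q i (f x) = g (p i x)]) ->
  frechet_smooth D f.
Proof.
move=> oD pl pc qP fg k; apply: (frechet_Ck_proj oD qP) => i.
have [A [g [oA gS Dg]]] := fg i.
have op_A : open (p i @^-1` A) by apply: open_comp => // x _; exact: pc.
apply: (frechet_Ck_eq op_A oD _ _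
  (frechet_Ck_precomp oA (pl i) (pc i) (banach_Ck_frechet oA (gS k)))).
  by move=> x /Dg[].
by move=> x /Dg[_ qE]; exact: esym.
Qed.

End frechet_Ck_theory.

(** * The model spaces are Fréchet spaces *)

Section frechet_spaces.
Context {R : realType}.

Definition seq_complete (V : normedModType R) :=
  forall u : nat -> V,
    (forall e, 0 < e -> exists N, forall m n, (N <= m)%N -> (N <= n)%N ->
       `|u m - u n| <= e) ->
    exists l : V, u @ \oo --> l.

Lemma complete_seq_complete (V : completeNormedModType R) : seq_complete V.
Proof.
move=> u uC; exists (lim (u @ \oo)); apply: cauchy_cvg.
apply/cauchy_ballP => e e0.
have [N uN] := uC (e / 2) (divr_gt0 e0 (ltr0Sn _ 1)).
exists ([set u n | n in [set n | (N <= n)%N]], [set u n | n in [set n | (N <= n)%N]]).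
  by split; exists N => // n /= Nn; exists n.
move=> [_ _] [/= [m Nm <-] [n Nn <-]]; rewrite -ball_normE /ball_/=.
apply: le_lt_trans (uN m n Nm Nn) _; rewrite ltr_pdivrMr// ltr_pMr//.
by rewrite ltr1n.
Qed.

Lemma cvg_le_norm (V : normedModType R) (u : nat -> V) l w (K : R) :
  u @ \oo --> l -> (\forall n \near \oo, `|w - u n| <= K) -> `|w - l| <= K.
Proof.
move=> ul wK; apply/ler_addgt0Pl => e e0.
near \oo => n.
have wn : `|w - u n| <= K by near: n.
have un : `|l - u n| <= e by near: n; move/cvgrPdist_le : ul; apply.
rewrite -(subrK (u n) w) -addrA addrC; apply: le_trans (ler_normD _ _) _.
by apply: lerD => //; rewrite distrC.
Unshelve. all: by end_near. Qed.

(** The limit is taken pointwise; the Cauchy estimate, passed to the limit at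
    each point, bounds the distance in operator norm. *)
Lemma contbil_seq_complete (V W : normedModType R) :
  seq_complete W -> seq_complete (contbil V W).
Proof.
move=> Wc u uC.
have u_lim p : exists l : W, (fun n => u n p) @ \oo --> l.
  case: p => x y; apply: Wc => e e0.
  have K0 : 0 < `|x| * `|y| + 1 by rewrite ltr_wpDl ?mulr_ge0.
  have [N uN] := uC (e / (`|x| * `|y| + 1)) (divr_gt0 e0 K0).
  exists N => m n Nm Nn.
  have := contbil_le (u m - u n) x y.
  have -> : (u m - u n) (x, y) = u m (x, y) - u n (x, y).
    by rewrite /= scaleN1r.
  move=> /le_trans; apply; rewrite -mulrA.
  apply: (@le_trans _ _ (e / (`|x| * `|y| + 1) * (`|x| * `|y| + 1))).
    by rewrite ler_pM ?mulr_ge0// ?uN// lerDl.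
  by rewrite divfK// gt_eqF.
have [b bl] := boolp.choice u_lim.
have lim_uniq p w : (fun n => u n p) @ \oo --> w -> w = b p.
  by move=> uw; apply: (cvg_unique _ uw (bl p)); exact: norm_hausdorff.
have dist_le N e x y : (forall n, (N <= n)%N -> `|u N - u n| <= e) ->
    `|u N (x, y) - b (x, y)| <= e * `|x| * `|y|.
  move=> uN; apply: (cvg_le_norm (bl (x, y))); exists N => // n /= Nn.
  have -> : u N (x, y) - u n (x, y) = (u N - u n) (x, y) by rewrite /= scaleN1r.
  apply: le_trans (contbil_le _ x y) _.
  by rewrite -!mulrA ler_wpM2r ?mulr_ge0// uN.
have bb : bounded_bilinear (fun x y => b (x, y)).
  split=> [y a x z|x a y z|].
  - apply/esym/lim_uniq; rewrite (_ : (fun n => _) =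
        (fun n => a *: u n (x, y) + u n (z, y))).
      by apply: cvgD (bl _); apply: cvgZl_tmp; exact: bl.
    by apply/funext => n; have [/(_ y)-> _ _] := opfunP (u n).
  - apply/esym/lim_uniq; rewrite (_ : (fun n => _) =
        (fun n => a *: u n (x, y) + u n (x, z))).
      by apply: cvgD (bl _); apply: cvgZl_tmp; exact: bl.
    by apply/funext => n; have [_ /(_ x)-> _] := opfunP (u n).
  have [N uN] := uC 1 ltr01.
  exists (1 + `|u N|) => [|x y]; first by rewrite addr_ge0.
  rewrite -[b (x, y)](subKr (u N (x, y))); apply: le_trans (ler_normB _ _) _.
  rewrite addrC -mulrA mulrDl mulrA [_ * (_ * _)]mulrA; apply: lerD.
    by apply: dist_le => n; exact: uN.
  exact: contbil_le.
exists (to_contbil b); apply/cvgrPdist_le => e e0.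
have [N uN] := uC e e0; exists N => // n /= Nn.
rewrite distrC; apply: contbil_norm_le => [|x y]; first exact: ltW.
have -> : (u n - to_contbil b) (x, y) = u n (x, y) - b (x, y).
  rewrite -(to_contbilE bb) /= scaleN1r.
  by congr (_ - to_contbil _ _); apply/funext => -[].
apply: dist_le => m nm; apply: uN => //; exact: leq_trans nm.
Qed.

(** A countable family of projections to normed spaces gives the countable
    basis of neighbourhoods: those where the first n coordinates are smaller
    than 1/(n+1). *)
Lemma projective_frechet (W : tvsType R) (Y : nat -> normedModType R)
    (q : forall i, W -> Y i) : (forall i, seq_complete (Y i)) ->
  projective_family q -> is_frechet_space W.
Proof.
move=> Yc [qlc qi qc qe].
have q0 i : q i 0 = 0.
  by have [/(_ (-1) 0 0)] := qlc i; rewrite !scaleN1r oppr0 addr0 addNr.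
have qB i x y : q i (x - y) = q i x - q i y.
  by rewrite addrC -scaleN1r (qlc i).1 scaleN1r addrC.
have q_ball i e : 0 < e -> nbhs (0 : W) [set w | `|q i w| < e].
  move=> e0; have : nbhs (q i 0) (ball (q i 0) e)
    by exact: (@nbhsx_ballx R (Y i) _ _ e0).
  move=> /((qlc i).2 0).
  apply: (@filterS _ (nbhs (0 : W)) _ (fun w => ball (q i 0) e (q i w))) => w.
  by rewrite -ball_normE /ball_/= q0 sub0r normrN.
split.
- move=> x y xy; apply: qi => i; apply: (@norm_hausdorff _ (Y i)) => A B.
  move=> /((qlc i).2 x) xA /((qlc i).2 y) yB.
  by have [z [Az Bz]] := xy _ _ xA yB; exists (q i z).
- pose B n := [set w : W | forall i : 'I_n.+1, `|q i w| < n.+1%:R^-1].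
  exists B; split=> [n|U].
    by apply: filter_forall => i; apply: q_ball; rewrite invr_gt0.
  have FB : Filter (filter_from setT B).
    apply: filter_from_filter; first by exists 0%N.
    move=> m n _ _; exists (maxn m n) => // w wB; split=> i.
      have im : (i < (maxn m n).+1)%N.
        by apply: leq_trans (ltn_ord i) _; rewrite ltnS leq_maxl.
      apply: lt_le_trans (wB (Ordinal im)) _.
      by rewrite lef_pV2 ?posrE// ler_nat ltnS leq_maxl.
    have im : (i < (maxn m n).+1)%N.
      by apply: leq_trans (ltn_ord i) _; rewrite ltnS leq_maxr.
    apply: lt_le_trans (wB (Ordinal im)) _.
    by rewrite lef_pV2 ?posrE// ler_nat ltnS leq_maxr.
  have /[apply] : filter_from setT B --> (0 : W).
    apply: qc => i A; rewrite q0 => /nbhs_ballP[e /= e0 eA].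
    have [n _ nP] := near_infty_natSinv_lt (PosNum e0).
    have im : (i < (maxn i n).+1)%N by rewrite ltnS leq_maxl.
    exists (maxn i n) => // w /(_ (Ordinal im)) /= wi; apply: eA.
    rewrite -ball_normE /ball_/= sub0r normrN; apply: lt_trans wi _.
    by apply: nP => /=; exact: leq_maxr.
  by move=> [n _ nU]; exists n.
- move=> u uC.
  have yX i : exists y : Y i, (fun n => q i (u n)) @ \oo --> y.
    apply: Yc => e e0; have [N uN] := uC _ (q_ball i e e0).
    by exists N => m n Nm Nn; have := uN m n Nm Nn; rewrite /= qB => /ltW.
  pose y i := projT1 (cid (yX i)).
  have yP i : (fun n => q i (u n)) @ \oo --> y i := projT2 (cid (yX i)).
  have [w wE] : exists w, forall i, q i w = y i.
    apply: (qe (u @ \oo)) => i.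
    exact: (yP i).
  exists w; apply: qc => i; rewrite wE.
  exact: (yP i).
Qed.

Lemma projective_familyX (W1 W2 : tvsType R) (Y1 Y2 : nat -> normedModType R)
    (q1 : forall i, W1 -> Y1 i) (q2 : forall i, W2 -> Y2 i) :
  projective_family q1 -> projective_family q2 ->
  @projective_family R (W1 * W2)%type (fun i => (Y1 i * Y2 i)%type)
    (fun i z => (q1 i z.1, q2 i z.2)).
Proof.
move=> [l1 i1 c1 e1] [l2 i2 c2 e2]; split.
- move=> i; have [l1i c1i] := l1 i; have [l2i c2i] := l2 i; split.
    by move=> a [x y] [z t] /=; rewrite l1i l2i.
  move=> [x y]; apply: cvg_pair.
    by apply: (@cvg_comp _ _ _ fst (q1 i)); [exact: cvg_fst|exact: c1i].
  by apply: (@cvg_comp _ _ _ snd (q2 i)); [exact: cvg_snd|exact: c2i].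
- move=> [x y] [z t] /= xyzt; congr (_, _).
    by apply: i1 => i; have [] := xyzt i.
  by apply: i2 => i; have [] := xyzt i.
- move=> F [x y] FF /= Fxy.
  have F1 : fst @ F --> x.
    apply: c1 => i; rewrite -fmap_comp.
    exact: (@cvg_comp _ _ _ _ fst _ _ _ (Fxy i) (@cvg_fst _ _ _ _ _)).
  have F2 : snd @ F --> y.
    apply: c2 => i; rewrite -fmap_comp.
    exact: (@cvg_comp _ _ _ _ snd _ _ _ (Fxy i) (@cvg_snd _ _ _ _ _)).
  have := cvg_pair F1 F2.
  rewrite (_ : (fun z => _) = id); last by apply/funext => -[].
  exact.
move=> F y FF Fy.
have [w1 w1E] : exists w, forall i, q1 i w = (y i).1.
  apply: (e1 (fst @ F)) => i; rewrite -fmap_comp.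
  exact: (@cvg_comp _ _ _ _ fst _ _ _ (Fy i) (@cvg_fst _ _ _ _ _)).
have [w2 w2E] : exists w, forall i, q2 i w = (y i).2.
  apply: (e2 (snd @ F)) => i; rewrite -fmap_comp.
  exact: (@cvg_comp _ _ _ _ snd _ _ _ (Fy i) (@cvg_snd _ _ _ _ _)).
by exists (w1, w2) => i /=; rewrite w1E w2E; case: (y i).
Qed.

Lemma projective_subprod (Y : nat -> normedModType R)
    (S : linset (fun i => Y i : tvsType R)) :
  (forall (F : set_system (subprod S)) (y : forall i, Y i), ProperFilter F ->
    (forall i, (fun x : subprod S => subprod_coord x i) @ F --> y i) -> lset S y) ->
  @projective_family R (subprod S) Y (fun i x => subprod_coord x i).
Proof.
move=> Sc; split.
- by move=> i; split=> // x; exact: subprod_coord_continuous.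
- by move=> x y; exact: subprod_ext.
- by move=> F x FF; exact: subprod_cvg.
by move=> F y FF Fy; exists (SubProd (Sc F y FF Fy)).
Qed.

Lemma seq_completeX (V W : normedModType R) : seq_complete V -> seq_complete W ->
  seq_complete (V * W)%type.
Proof.
move=> Vc Wc u uC.
have [v uv] : exists v : V, (fun n => (u n).1) @ \oo --> v.
  apply: Vc => e e0; have [N uN] := uC e e0; exists N => m n Nm Nn.
  apply: le_trans (uN m n Nm Nn); by rewrite prod_normE le_max lexx.
have [w uw] : exists w : W, (fun n => (u n).2) @ \oo --> w.
  apply: Wc => e e0; have [N uN] := uC e e0; exists N => m n Nm Nn.
  apply: le_trans (uN m n Nm Nn); by rewrite prod_normE le_max lexx orbT.
exists (v, w).
have uE : (fun n => ((u n).1, (u n).2)) = u by apply/funext => n; case: (u n).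
by rewrite -uE; exact: cvg_pair uv uw.
Qed.

End frechet_spaces.

Section limit_spaces.
Context {R : realType} (E : banach_system R).

(** Coherence of a sequence is an equation between continuous functions of its
    coordinates, so that it passes to coordinatewise limits. *)
Lemma projective_bs_lim :
  @projective_family R (bs_lim E) (fun i => E i) (fun i x => subprod_coord x i).
Proof.
apply: projective_subprod => F y FF Fy i j h.
have Fj : (fun x : bs_lim E => bs_map E h (subprod_coord x j : E j)) @ F -->
    bs_map E h (y j).
  by apply: continuous_cvg (Fy j); exact: bs_map_continuous.
apply: (cvg_unique _ Fj); first exact: norm_hausdorff.
rewrite (_ : (fun x : bs_lim E => _) = (fun x => subprod_coord x i)); first exact: Fy.
by apply/funext => x; exact: (subprod_coordP x).
Qed.

Lemma contbil_eval_continuous (V W : normedModType R) x y :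
  continuous (fun B : contbil V W => B (x, y)).
Proof.
apply: bounded_linear_map_continuous; split=> //.
exists (`|x| * `|y|) => B; apply: le_trans (contbil_le _ _ _) _.
by rewrite -mulrA mulrC.
Qed.

Lemma projective_H2 :
  @projective_family R (H2 E) (fun i => contbil (E i) (E i))
    (fun i x => subprod_coord x i).
Proof.
apply: projective_subprod => F y FF Fy i j h e1 e2.
have Fj : (fun x : H2 E =>
      bs_map E h ((subprod_coord x j : contbil (E j) (E j)) (e1, e2)))
    @ F --> bs_map E h (y j (e1, e2)).
  apply: (continuous_cvg _ (@bs_map_continuous R E i j h _)).
  exact: (continuous_cvg _ (@contbil_eval_continuous _ _ e1 e2 _) (Fy j)).
apply/esym; apply: (cvg_unique _ Fj); first exact: norm_hausdorff.
rewrite (_ : (fun x : H2 E => _) = (fun x : H2 E =>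
  (subprod_coord x i : contbil (E i) (E i)) (bs_map E h e1, bs_map E h e2))).
  exact: (continuous_cvg _ (@contbil_eval_continuous _ _ _ _ _) (Fy i)).
by apply/funext => x; apply/esym; exact: (subprod_coordP x).
Qed.

Lemma projective_bs_lim_H2 :
  @projective_family R (bs_lim E * H2 E)%type
    (fun i => (E i * contbil (E i) (E i))%type)
    (fun i z => (subprod_coord z.1 i, subprod_coord z.2 i)).
Proof. exact: projective_familyX projective_bs_lim projective_H2. Qed.

Lemma bs_lim_frechet : is_frechet_space (bs_lim E).
Proof.
by apply: projective_frechet projective_bs_lim => i; exact: complete_seq_complete.
Qed.

Lemma H2_frechet : is_frechet_space (H2 E).
Proof.
apply: projective_frechet projective_H2 => i; apply: contbil_seq_complete.
exact: complete_seq_complete.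
Qed.

Lemma bs_lim_H2_frechet : is_frechet_space (bs_lim E * H2 E)%type.
Proof.
apply: projective_frechet projective_bs_lim_H2 => i; apply: seq_completeX.
  exact: complete_seq_complete.
by apply: contbil_seq_complete; exact: complete_seq_complete.
Qed.

End limit_spaces.

(** * Smooth maps, second derivatives and operations on bilinear maps *)

Section smooth_maps.
Context {R : realType}.
Implicit Types (U V W X : normedModType R).

Lemma banach_smooth_diff V W (D : set V) (f : V -> W) x : open D ->
  banach_smooth D f -> D x -> differentiable f x.
Proof. by move=> oD /(_ 1%N) /(banach_CkS _ _ oD)[+ _]; exact. Qed.

Lemma banach_smooth_Dmap V W (D : set V) (f : V -> W) : open D ->
  banach_smooth D f -> banach_smooth D (Dmap f).
Proof. by move=> oD fS k; have /(banach_CkS _ _ oD)[] := fS k.+1. Qed.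

Lemma banach_smooth_comp U V W (D : set U) (D' : set V) (f : U -> V)
    (g : V -> W) : open D -> open D' -> (forall x, D x -> D' (f x)) ->
  banach_smooth D f -> banach_smooth D' g -> banach_smooth D (g \o f).
Proof.
by move=> oD oD' DD' fS gS k; exact: (banach_Ck_comp oD oD' DD' (fS k) (gS k)).
Qed.

Lemma banach_smooth_bilin X U V W (b : U -> V -> W) (D : set X) f g : open D ->
  bounded_bilinear b -> banach_smooth D f -> banach_smooth D g ->
  banach_smooth D (fun x => b (f x) (g x)).
Proof. by move=> oD bB fS gS k; exact: (banach_Ck_bilin oD bB (fS k) (gS k)). Qed.

Lemma banach_smoothD V W (D : set V) (f g : V -> W) : open D ->
  banach_smooth D f -> banach_smooth D g -> banach_smooth D (fun x => f x + g x).
Proof. by move=> oD fS gS k; exact: (banach_CkD oD (fS k) (gS k)). Qed.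

Lemma banach_smooth_linear V W (D : set V) (f : V -> W) : open D ->
  bounded_linear f -> banach_smooth D f.
Proof. by move=> oD fB k; exact: banach_Ck_linear. Qed.

Lemma banach_smooth_eq V W (D D' : set V) (f g : V -> W) :
  open D -> open D' -> D' `<=` D -> (forall x, D' x -> f x = g x) ->
  banach_smooth D f -> banach_smooth D' g.
Proof. by move=> oD oD' DD fg fS k; exact: (banach_Ck_eq oD oD' DD fg (fS k)). Qed.

Lemma bounded_linear_fst V W : bounded_linear (@fst V W).
Proof.
split; first by move=> a [x y] [z t].
by exists 1 => x; rewrite mul1r prod_normE/= le_max lexx.
Qed.

Lemma bounded_linear_snd V W : bounded_linear (@snd V W).
Proof.
split; first by move=> a [x y] [z t].
by exists 1 => x; rewrite mul1r prod_normE/= le_max lexx orbT.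
Qed.

Lemma banach_smooth_pair U V W (D : set U) (f : U -> V) (g : U -> W) : open D ->
  banach_smooth D f -> banach_smooth D g -> banach_smooth D (fun x => (f x, g x)).
Proof.
move=> oD fS gS.
have inl : bounded_linear (fun v : V => (v, 0 : W)).
  split; first by move=> a x y; congr (_, _); rewrite /= scaler0 addr0.
  by exists 1 => x; rewrite mul1r prod_normE/= normr0 ge_max lexx normr_ge0.
have inr : bounded_linear (fun w : W => (0 : V, w)).
  split; first by move=> a x y; congr (_, _); rewrite /= scaler0 addr0.
  by exists 1 => x; rewrite mul1r prod_normE/= normr0 ge_max lexx normr_ge0.
have := banach_smoothD oD
  (banach_smooth_comp oD openT (fun _ _ => I) fS (banach_smooth_linear openT inl))
  (banach_smooth_comp oD openT (fun _ _ => I) gS (banach_smooth_linear openT inr)).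
apply: banach_smooth_eq => // x _.
by congr (_, _); rewrite /= ?addr0 ?add0r.
Qed.

Lemma Dmap_near_linear V W (f L : V -> W) x : bounded_linear L ->
  (\forall y \near x, f y = L y) ->
  (forall v, Dmap f x v = L v) /\ (forall v w, Dmap (Dmap f) x v w = 0).
Proof.
move=> bL fL.
have DL y : Dmap L y = to_contlin L.
  have [d dE] := diff_bounded_linear y bL.
  by apply: Dmap_eq => //; rewrite dE to_contlinE.
have dL y : differentiable L y by have [] := diff_bounded_linear y bL.
have Lf : \forall y \near x, L y = f y by apply: filterS fL.
have DfE : \forall y \near x, Dmap f y = to_contlin L.
  move/near_join : Lf; apply: filterS => y fy.
  by rewrite (near_eq_Dmap fy)// DL.
split=> [v|v w].
  by rewrite (nbhs_singleton DfE) to_contlinE.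
have cDf : \forall y \near x, cst (to_contlin L) y = Dmap f y.
  by apply: filterS DfE => y ->.
rewrite (near_eq_Dmap cDf); last exact: differentiable_cst.
have -> : Dmap (cst (to_contlin L)) x = 0.
  by apply: Dmap_eq; [exact: differentiable_cst|rewrite diff_cst].
by [].
Qed.

Lemma Dmap_eq_on V W (D : set V) (f g : V -> W) x : open D ->
  banach_smooth D f -> (forall y, D y -> f y = g y) -> D x ->
  Dmap g x = Dmap f x /\ Dmap (Dmap g) x = Dmap (Dmap f) x.
Proof.
move=> oD fS fg Dx.
have DfE y : D y -> Dmap f y = Dmap g y.
  move=> Dy; apply/esym; apply: near_eq_Dmap; first exact: (open_near_eq oD fg Dy).
  exact: (banach_smooth_diff oD fS Dy).
split; first by rewrite DfE.
apply: near_eq_Dmap; first exact: (open_near_eq oD DfE Dx).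
exact: (banach_smooth_diff oD (banach_smooth_Dmap oD fS) Dx).
Qed.

(** Chain rules of orders one and two; the second is the origin of the
    inhomogeneous term in the transformation law of Christoffel symbols. *)
Lemma Dmap_comp U V W (D : set U) (D' : set V) (f : U -> V) (g : V -> W) x :
  open D -> open D' -> (forall x, D x -> D' (f x)) ->
  banach_smooth D f -> banach_smooth D' g -> D x ->
  (forall v, Dmap (g \o f) x v = Dmap g (f x) (Dmap f x v)) /\
  (forall v w, Dmap (Dmap (g \o f)) x v w =
    Dmap (Dmap g) (f x) (Dmap f x v) (Dmap f x w) +
    Dmap g (f x) (Dmap (Dmap f) x v w)).
Proof.
move=> oD oD' DD' fS gS Dx.
have df y : D y -> differentiable f y by exact: banach_smooth_diff.
have dg y : D' y -> differentiable g y by exact: banach_smooth_diff.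
have dDf : differentiable (Dmap f) x.
  exact: banach_smooth_diff (banach_smooth_Dmap oD fS) _.
have dDg : differentiable (Dmap g) (f x).
  by apply: (banach_smooth_diff oD' (banach_smooth_Dmap oD' gS)); exact: DD'.
have D1 y v : D y -> Dmap (g \o f) y v = Dmap g (f y) (Dmap f y v).
  move=> Dy; rewrite DmapE; last by apply: differentiable_comp; [exact: df|exact/dg/DD'].
  rewrite diff_comp; [|exact: df|exact/dg/DD'].
  by rewrite /= !DmapE//; [exact: df|exact/dg/DD'].
split=> [v|v w]; first exact: D1.
(* The first derivative of the composite is the bilinear expression b in
   (Dg o f, Df); differentiating it once more gives the two terms. *)
pose b := bilin_r (X := U) (fun (A : contlin V W) (y : V) => A y).
have eB := contlin_eval_bounded V W.
have bB : bounded_bilinear b := bilin_r_bounded U eB.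
have D2 : \forall y \near x, b (Dmap g (f y)) (Dmap f y) = Dmap (g \o f) y.
  apply: filterS (open_nbhs_nbhs (conj oD Dx)) => y Dy.
  by apply: optype_ext => u; rewrite /b bilin_rE// D1.
have dDgf : differentiable (fun y => Dmap g (f y)) x.
  exact: (differentiable_comp (df _ Dx) dDg).
have [d dE] := diff_bounded_bilinear bB dDgf dDf.
rewrite (near_eq_Dmap D2 d) DmapE// dE /=.
have -> : 'd (fun y => Dmap g (f y)) x v = 'd (Dmap g) (f x) ('d f x v).
  by rewrite (diff_comp (f := f) (g := Dmap g) (df _ Dx) dDg).
by rewrite /b !bilin_rE// !DmapE//; [rewrite addrC|exact: df|exact/dg/DD'].
Qed.

(** Both sides of g o L = L o f are differentiated twice; the second derivative
    of L vanishes. *)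
Lemma Dmap_intertwine V W (L : V -> W) (D : set V) (D' : set W) (f : V -> V)
    (g : W -> W) x : bounded_linear L -> open D -> open D' ->
  (forall y, D y -> D' (L y)) -> (forall y, D y -> g (L y) = L (f y)) ->
  banach_smooth D f -> banach_smooth D' g -> D x ->
  (forall v, Dmap g (L x) (L v) = L (Dmap f x v)) /\
  (forall v w, Dmap (Dmap g) (L x) (L v) (L w) = L (Dmap (Dmap f) x v w)).
Proof.
move=> bL oD oD' DD' gL fS gS Dx.
have LS (A : set V) : open A -> banach_smooth A L.
  by move=> oA; exact: banach_smooth_linear.
have DL y : (forall v, Dmap L y v = L v) /\ (forall v w, Dmap (Dmap L) y v w = 0).
  by apply: (Dmap_near_linear bL); exact: nearW.
have [Lf1 Lf2] := Dmap_comp oD openT (fun _ _ => I) fS (LS _ openT) Dx.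
have [gL1 gL2] := Dmap_comp oD oD' DD' (LS _ oD) gS Dx.
have [E1 E2] := Dmap_eq_on oD (banach_smooth_comp oD oD' DD' (LS _ oD) gS) gL Dx.
split=> [v|v w].
  apply: etrans (congr1 (Dmap g (L x)) (esym ((DL x).1 v))) _.
  apply: etrans (esym (gL1 v)) _.
  apply: etrans (etrans (Lf1 v) ((DL (f x)).1 (Dmap f x v))).
  exact: (congr1 (fun A : contlin V W => A v) (esym E1)).
have gE : Dmap (Dmap (g \o L)) x v w = Dmap (Dmap g) (L x) (L v) (L w).
  apply: etrans (gL2 v w) _; apply: etrans (addr0 _); congr (_ + _).
    exact: (f_equal2 (fun a b => Dmap (Dmap g) (L x) a b) ((DL x).1 v) ((DL x).1 w)).
  apply: etrans (congr1 (Dmap g (L x)) ((DL x).2 v w)) _.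
  exact: (linear_fun0 (@contlin_linear _ _ _ _)).
have fE : Dmap (Dmap (L \o f)) x v w = L (Dmap (Dmap f) x v w).
  apply: etrans (Lf2 v w) _; apply: etrans (add0r _); congr (_ + _).
    exact: (DL (f x)).2.
  exact: (DL (f x)).1.
apply: etrans (esym gE) _; apply: etrans _ fE.
exact: (congr1 (fun A : contlin V (contlin V W) => A v w) (esym E2)).
Qed.

(** The iterated differential with frozen second direction, as it occurs in the
    definition of equivalent triples, is the second derivative. *)
Lemma diff_diff V W (D : set V) (f : V -> W) x v w : open D ->
  banach_smooth D f -> D x ->
  'd (fun y => 'd f y w) x v = Dmap (Dmap f) x v w.
Proof.
move=> oD fS Dx.
have df y : D y -> differentiable f y by exact: banach_smooth_diff.
have dDf : differentiable (Dmap f) x.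
  exact: banach_smooth_diff (banach_smooth_Dmap oD fS) _.
have ev : bounded_linear (fun A : contlin V W => A w).
  split=> //; exists `|w| => A; rewrite mulrC; exact: contlin_le.
have [dev devE] := diff_bounded_linear (Dmap f x) ev.
have fE : \forall y \near x, Dmap f y w = 'd f y w.
  apply: filterS (open_nbhs_nbhs (conj oD Dx)) => y Dy.
  by rewrite DmapE//; exact: df.
have [_ ->] := near_eq_diff fE (differentiable_comp dDf dev).
by rewrite (diff_comp (f := Dmap f) (g := fun A : contlin V W => A w))//= devE DmapE.
Qed.

End smooth_maps.

Section bilinear_pullback.
Context {R : realType}.
Implicit Types (V W : normedModType R).

Definition push_contbil V W W' (A : contlin W W') (B : contbil V W) : contbil V W' :=
  to_contbil (fun p => A (B p)).
(** The pull-back of a bilinear map along A in both arguments is quadratic in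
    A. It is split into two steps that are each linear in A, to which the
    product rule applies. *)
Definition pull1_contbil V W (B : contbil V W) (A : contlin V V) : contbil V W :=
  to_contbil (fun p => B (A p.1, p.2)).
Definition pull2_contbil V W (B : contbil V W) (A : contlin V V) : contbil V W :=
  to_contbil (fun p => B (p.1, A p.2)).
Definition uncurry_contlin V W (Q : contlin V (contlin V W)) : contbil V W :=
  to_contbil (fun p => Q p.1 p.2).

Lemma push_contbilE V W W' (A : contlin W W') (B : contbil V W) x y :
  push_contbil A B (x, y) = A (B (x, y)).
Proof.
have [Bl Br [C C0 BC]] := contbilP B.
rewrite /push_contbil (_ : (fun p => _) = (fun p => A (B (p.1, p.2)))); last first.
  by apply/funext => -[].
rewrite (to_contbilE (b := fun x y => A (B (x, y))))//; split.
- by move=> z a u v; rewrite Bl contlin_linear.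
- by move=> z a u v; rewrite Br contlin_linear.
exists (`|A| * C) => [|u v]; first by rewrite mulr_ge0.
by apply: le_trans (contlin_le _ _) _; rewrite -!mulrA ler_wpM2l// mulrA BC.
Qed.

Lemma pull1_contbilE V W (B : contbil V W) (A : contlin V V) x y :
  pull1_contbil B A (x, y) = B (A x, y).
Proof.
have [Bl Br _] := contbilP B.
rewrite /pull1_contbil (to_contbilE (b := fun x y => B (A x, y)))//; split.
- by move=> z a u v; rewrite contlin_linear Bl.
- by move=> z a u v; rewrite Br.
exists (`|B| * `|A|) => [|u v]; first by rewrite mulr_ge0.
apply: le_trans (contbil_le _ _ _) _.
by rewrite ler_wpM2r// -mulrA ler_wpM2l// contlin_le.
Qed.

Lemma pull2_contbilE V W (B : contbil V W) (A : contlin V V) x y :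
  pull2_contbil B A (x, y) = B (x, A y).
Proof.
have [Bl Br _] := contbilP B.
rewrite /pull2_contbil (to_contbilE (b := fun x y => B (x, A y)))//; split.
- by move=> z a u v; rewrite Bl.
- by move=> z a u v; rewrite contlin_linear Br.
exists (`|B| * `|A|) => [|u v]; first by rewrite mulr_ge0.
apply: le_trans (contbil_le _ _ _) _.
rewrite -!mulrA ler_wpM2l// mulrCA ler_wpM2l// contlin_le.
by [].
Qed.

Lemma uncurry_contlinE V W (Q : contlin V (contlin V W)) x y :
  uncurry_contlin Q (x, y) = Q x y.
Proof.
rewrite /uncurry_contlin (to_contbilE (b := fun x y => Q x y))//; split.
- by move=> z a u v; rewrite contlin_linear.
- by move=> z a u v; rewrite contlin_linear.
exists `|Q| => // u v; apply: le_trans (contlin_le _ _) _.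
by rewrite ler_wpM2r// contlin_le.
Qed.

Lemma push_contbil_bounded V W W' :
  bounded_bilinear (@push_contbil V W W').
Proof.
split=> [B a A A'|A a B B'|].
- by apply: optype_ext => -[x y]; rewrite /= !push_contbilE.
- by apply: optype_ext => -[x y]; rewrite /= !push_contbilE/= contlin_linear.
exists 1 => // A B; rewrite mul1r; apply: contbil_norm_le => [|x y].
  by rewrite mulr_ge0.
rewrite push_contbilE; apply: le_trans (contlin_le _ _) _.
by rewrite -!mulrA ler_wpM2l// mulrA contbil_le.
Qed.

Lemma pull1_contbil_bounded V W : bounded_bilinear (@pull1_contbil V W).
Proof.
split=> [A a B B'|B a A A'|].
- by apply: optype_ext => -[x y]; rewrite /= !pull1_contbilE.
- apply: optype_ext => -[x y]; rewrite /= !pull1_contbilE/=.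
  by have [Bl _ _] := contbilP B; rewrite Bl.
exists 1 => // B A; rewrite mul1r; apply: contbil_norm_le => [|x y].
  by rewrite mulr_ge0.
rewrite pull1_contbilE; apply: le_trans (contbil_le _ _ _) _.
by rewrite ler_wpM2r// -mulrA ler_wpM2l// contlin_le.
Qed.

Lemma pull2_contbil_bounded V W : bounded_bilinear (@pull2_contbil V W).
Proof.
split=> [A a B B'|B a A A'|].
- by apply: optype_ext => -[x y]; rewrite /= !pull2_contbilE.
- apply: optype_ext => -[x y]; rewrite /= !pull2_contbilE/=.
  by have [_ Br _] := contbilP B; rewrite Br.
exists 1 => // B A; rewrite mul1r; apply: contbil_norm_le => [|x y].
  by rewrite mulr_ge0.
rewrite pull2_contbilE; apply: le_trans (contbil_le _ _ _) _.
by rewrite -!mulrA ler_wpM2l// mulrCA ler_wpM2l// contlin_le.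
Qed.

Lemma uncurry_contlin_bounded V W : bounded_linear (@uncurry_contlin V W).
Proof.
split=> [a Q Q'|].
  by apply: optype_ext => -[x y]; rewrite /= !uncurry_contlinE.
exists 1 => Q; rewrite mul1r; apply: contbil_norm_le => // x y.
rewrite uncurry_contlinE; apply: le_trans (contlin_le _ _) _.
by rewrite ler_wpM2r// contlin_le.
Qed.

End bilinear_pullback.

(** * Chart changes and the transformation law of Christoffel elements *)

Section charts.
Context {N E : topologicalType}.
Implicit Types (c d e : chart N E) (D : set N).

Lemma chart_open_image c D : open D -> D `<=` cdom c -> open (c @` D).
Proof.
move=> oD Dc; have := @cinv_continuous _ _ c.
rewrite continuous_open_subspace; last exact: cimg_open.
move=> /(continuous_inP _ (cimg_open c)) /(_ _ oD).
congr open; apply/seteqP; split => [z [[x cx <-]] /=|_ [x Dx <-]].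
  by rewrite cmapK// => Dx; exists x.
by split=> /=; [exists x => //; exact: Dc|rewrite cmapK//; exact: Dc].
Qed.

Definition overlap c d : set E := c @` (cdom c `&` cdom d).

Lemma overlap_open c d : open (overlap c d).
Proof.
by apply: chart_open_image; [apply: openI; exact: cdom_open|move=> x []].
Qed.

Lemma chart_changeE c d x : cdom c x -> chart_change c d (c x) = d x.
Proof. by move=> cx; rewrite /chart_change/= cmapK. Qed.

Lemma overlapP c d x : cdom c x -> cdom d x -> overlap c d (c x).
Proof. by move=> cx dx; exists x. Qed.

Lemma chart_near c D x : open D -> D `<=` cdom c -> D x ->
  \forall z \near c x, exists2 y, D y & c y = z.
Proof.
move=> oD Dc Dx; apply: (open_nbhs_nbhs (conj (chart_open_image oD Dc) _)).
by exists x.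
Qed.

End charts.

(** The algebra of the cocycle property: affine maps B |-> A B(A'_, A'_) + Q
    compose when the linear parts compose and the quadratic parts obey the
    second order chain rule. *)
Lemma affine_cocycle (V : zmodType) (A C K A' C' K' : V -> V)
    (QA QC QK b : V -> V -> V) x y :
  (forall v, K v = C (A v)) -> (forall v, K' v = A' (C' v)) ->
  (forall v w, QK v w = QC (A v) (A w) + C (QA v w)) ->
  (forall v, A (A' v) = v) -> {morph C : v w / v + w} ->
  C (A (b (A' (C' x)) (A' (C' y))) + QA (A' (C' x)) (A' (C' y))) +
    QC (C' x) (C' y) = K (b (K' x) (K' y)) + QK (K' x) (K' y).
Proof.
by move=> KE K'E QKE AK CD; rewrite QKE !K'E KE CD !AK [in RHS]addrCA addrC.
Qed.

Section banach_charts.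
Context {R : realType} {E : completeNormedModType R} (N : banach_manifold E).
Implicit Types (c d e : chart N E) (m : N) (B : contbil E E).

(** Charts of the maximal atlas are compatible with the charts of the given
    atlas by definition. Two of them are compatible with each other because
    smoothness is local: near a point the change factors through a chart of the
    atlas. *)
Lemma chart_change_smooth c d : manifold_chart c -> manifold_chart d ->
  banach_smooth (overlap c d) (chart_change c d).
Proof.
move=> cM dM k; apply: (banach_Ck_local (overlap_open c d)) => _ [x [cx dx] <-].
have [a aA ax] := (bm_atlasP N).1 x.
have [ca _] := cM a aA; have [_ ad] := dM a aA.
have oD : open (cdom c `&` cdom d `&` cdom a).
  by apply: openI; [apply: openI|]; exact: cdom_open.
have oI : open (c @` (cdom c `&` cdom d `&` cdom a)).
  by apply: chart_open_image => // y [[]].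
exists (c @` (cdom c `&` cdom d `&` cdom a)); split=> //.
  by exists x.
have sub : c @` (cdom c `&` cdom d `&` cdom a) `<=` overlap c a.
  by move=> _ [y [[cy _] ay] <-]; exists y.
have caD : banach_Ck k (c @` (cdom c `&` cdom d `&` cdom a)) (chart_change c a).
  exact: (banach_Ck_eq (overlap_open c a) oI sub (fun _ _ => erefl) (ca k)).
have toad z : (c @` (cdom c `&` cdom d `&` cdom a)) z -> overlap a d (chart_change c a z).
  by move=> [y [[cy dy] ay] <-]; rewrite chart_changeE//; exists y.
apply: (banach_Ck_eq oI oI (@subset_refl _ _) _
  (banach_Ck_comp oI (overlap_open a d) toad caD (ad k))).
by move=> _ [y [[cy dy] ay] <-]; rewrite /= !chart_changeE.
Qed.

(** The transformation law of Christoffel elements from the chart c to the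
    chart d, at the point with coordinates z.1; A stands for the inverse of the
    derivative of the change of charts, obtained as the derivative of the
    inverse change. *)
Definition christoffel_tr c d (z : E * contbil E E) : contbil E E :=
  let F := chart_change c d in
  let A := Dmap (chart_change d c) (F z.1) in
  pull2_contbil (pull1_contbil
    (push_contbil (Dmap F z.1) z.2 + uncurry_contlin (Dmap (Dmap F) z.1)) A) A.

Lemma christoffel_trE c d z x y :
  let A := Dmap (chart_change d c) (chart_change c d z.1) in
  christoffel_tr c d z (x, y) = Dmap (chart_change c d) z.1 (z.2 (A x, A y)) +
    Dmap (Dmap (chart_change c d)) z.1 (A x) (A y).
Proof.
rewrite /christoffel_tr pull2_contbilE pull1_contbilE -[LHS]/(_ + _).
by rewrite push_contbilE uncurry_contlinE.
Qed.

Lemma christoffel_tr_smooth c d : manifold_chart c -> manifold_chart d ->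
  banach_smooth (overlap c d `*` setT) (christoffel_tr c d).
Proof.
move=> cM dM; set D := _ `*` _.
have oD : open D by apply: open_cylinder; exact: overlap_open.
have o1 := overlap_open c d; have o2 := overlap_open d c.
have D1 z : D z -> overlap c d z.1 by case.
have fstS := banach_smooth_linear oD (bounded_linear_fst E (contbil E E)).
have sndS := banach_smooth_linear oD (bounded_linear_snd E (contbil E E)).
have FS := chart_change_smooth cM dM.
have DFS := banach_smooth_Dmap o1 FS.
have DDFS := banach_smooth_Dmap o1 DFS.
have AS : banach_smooth D (fun z => Dmap (chart_change d c) (chart_change c d z.1)).
  apply: (banach_smooth_comp oD o2 (f := chart_change c d \o fst)).
  - by move=> z /D1[x [cx dx] /= <-]; rewrite chart_changeE//; exact: overlapP.
  - exact: (banach_smooth_comp oD o1 D1 fstS FS).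
  - exact: (banach_smooth_Dmap o2 (chart_change_smooth dM cM)).
apply: (banach_smooth_bilin oD (pull2_contbil_bounded E E) _ AS).
apply: (banach_smooth_bilin oD (pull1_contbil_bounded E E) _ AS).
apply: (banach_smoothD oD).
  apply: (banach_smooth_bilin oD (push_contbil_bounded E E E) _ sndS).
  exact: (banach_smooth_comp oD o1 D1 fstS DFS).
apply: (banach_smooth_comp oD openT (fun _ _ => I)
  (banach_smooth_comp oD o1 D1 fstS DDFS)).
exact: (banach_smooth_linear openT (@uncurry_contlin_bounded _ E E)).
Qed.

Local Opaque Dmap chart_change.

Section at_point.
Variable m : N.

Lemma Dmap_chart_change c d e : manifold_chart c -> manifold_chart d ->
  manifold_chart e -> cdom c m -> cdom d m -> cdom e m ->
  (forall v, Dmap (chart_change c e) (c m) v =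
    Dmap (chart_change d e) (d m) (Dmap (chart_change c d) (c m) v)) /\
  (forall v w, Dmap (Dmap (chart_change c e)) (c m) v w =
    Dmap (Dmap (chart_change d e)) (d m) (Dmap (chart_change c d) (c m) v)
      (Dmap (chart_change c d) (c m) w) +
    Dmap (chart_change d e) (d m) (Dmap (Dmap (chart_change c d)) (c m) v w)).
Proof.
move=> cM dM eM cm dm em.
pose D := c @` (cdom c `&` cdom d `&` cdom e).
have oD : open D.
  by apply: chart_open_image => [|y [[]]//]; apply: openI; [apply: openI|];
    exact: cdom_open.
have Dm : D (c m) by exists m.
have De x : D x -> overlap d e (chart_change c d x).
  by move=> [y [[cy dy] ey] <-]; rewrite chart_changeE//; exact: overlapP.
have FS : banach_smooth D (chart_change c d).
  apply: (banach_smooth_eq (overlap_open c d) oD _ _ (chart_change_smooth cM dM)).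
    by move=> _ [y [[cy dy] ey] <-]; exact: overlapP.
  by [].
have := Dmap_comp oD (overlap_open d e) De FS (chart_change_smooth dM eM) Dm.
have FG x : D x -> (chart_change d e \o chart_change c d) x = chart_change c e x.
  by move=> [y [[cy dy] ey] <-]; rewrite /= !chart_changeE.
have [E1 E2] := Dmap_eq_on oD (banach_smooth_comp oD (overlap_open d e) De FS
  (chart_change_smooth dM eM)) FG Dm.
rewrite (chart_changeE d cm) => -[H1 H2].
split=> [v|v w].
  exact: etrans (congr1 (fun A : contlin E E => A v) E1) (H1 v).
exact: etrans (congr1 (fun A : contlin E (contlin E E) => A v w) E2) (H2 v w).
Qed.

Lemma Dmap_chart_change_id c : cdom c m ->
  (forall v, Dmap (chart_change c c) (c m) v = v) /\
  (forall v w, Dmap (Dmap (chart_change c c)) (c m) v w = 0).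
Proof.
move=> cm; apply: (Dmap_near_linear (L := id)).
  by split=> //; exists 1 => y; rewrite mul1r.
have := chart_near (cdom_open c) (fun _ => id) cm.
by apply: filterS => _ [y cy <-]; rewrite chart_changeE.
Qed.

Lemma Dmap_chart_changeK c d : manifold_chart c -> manifold_chart d ->
  cdom c m -> cdom d m -> forall v,
  Dmap (chart_change d c) (d m) (Dmap (chart_change c d) (c m) v) = v.
Proof.
move=> cM dM cm dm v.
by rewrite -(Dmap_chart_change cM dM cM cm dm cm).1 (Dmap_chart_change_id cm).1.
Qed.

Lemma christoffel_tr_ptE c d B x y : cdom c m ->
  christoffel_tr c d (c m, B) (x, y) =
  Dmap (chart_change c d) (c m)
    (B (Dmap (chart_change d c) (d m) x, Dmap (chart_change d c) (d m) y)) +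
  Dmap (Dmap (chart_change c d)) (c m)
    (Dmap (chart_change d c) (d m) x) (Dmap (chart_change d c) (d m) y).
Proof. by move=> cm; rewrite christoffel_trE /= (chart_changeE d cm). Qed.

Lemma christoffel_tr_id c B : cdom c m -> christoffel_tr c c (c m, B) = B.
Proof.
move=> cm; apply: optype_ext => -[x y]; rewrite (christoffel_tr_ptE c B x y cm).
have [D1 D2] := Dmap_chart_change_id cm.
by rewrite !D1 D2 addr0.
Qed.

(** In terms of classes: representatives in three charts are compatible. With
    [christoffel_tr_id] this gives symmetry and transitivity of the equivalence of
    triples. *)
Lemma christoffel_tr_comp c d e B : manifold_chart c -> manifold_chart d ->
  manifold_chart e -> cdom c m -> cdom d m -> cdom e m ->
  christoffel_tr d e (d m, christoffel_tr c d (c m, B)) = christoffel_tr c e (c m, B).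
Proof.
move=> cM dM eM cm dm em; apply: optype_ext => -[x y].
apply: etrans (christoffel_tr_ptE e _ x y dm) _.
apply: etrans (esym (christoffel_tr_ptE e B x y cm)).
rewrite (christoffel_tr_ptE d B _ _ cm).
have [D1 D2] := Dmap_chart_change cM dM eM cm dm em.
have [D1' _] := Dmap_chart_change eM dM cM em dm cm.
have K := Dmap_chart_changeK dM cM dm cm.
exact: (@affine_cocycle E (Dmap (chart_change c d) (c m))
  (Dmap (chart_change d e) (d m)) (Dmap (chart_change c e) (c m))
  (Dmap (chart_change d c) (d m)) (Dmap (chart_change e d) (e m))
  (Dmap (chart_change e c) (e m))
  (fun v w => Dmap (Dmap (chart_change c d)) (c m) v w)
  (fun v w => Dmap (Dmap (chart_change d e)) (d m) v w)
  (fun v w => Dmap (Dmap (chart_change c e)) (c m) v w)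
  (fun v w => B (v, w)) x y D1 D1' D2 K
  (contlin_linearD (Dmap (chart_change d e) (d m)))).
Qed.

(** The derivative of the change of charts is invertible, so that the condition
    on B'(DF e1, DF e2) determines B'. *)
Lemma christoffel_equivP c d B B' : manifold_chart c -> manifold_chart d ->
  cdom c m -> cdom d m ->
  christoffel_equiv m (c, B) (d, B') <-> B' = christoffel_tr c d (c m, B).
Proof.
move=> cM dM cm dm.
have oD := overlap_open c d; have FS := chart_change_smooth cM dM.
have Dm : overlap c d (c m) by exact: overlapP.
have dF := banach_smooth_diff oD FS Dm.
have equivE : christoffel_equiv m (c, B) (d, B') <-> forall x y,
    B' (Dmap (chart_change c d) (c m) x, Dmap (chart_change c d) (c m) y) =
    Dmap (chart_change c d) (c m) (B (x, y)) +
    Dmap (Dmap (chart_change c d)) (c m) x y.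
  have dE z : 'd (chart_change c d) (c m) z = Dmap (chart_change c d) (c m) z.
    by rewrite (DmapE dF).
  rewrite (_ : christoffel_equiv _ _ _ = forall e1 e2 : E,
    B' ('d (chart_change c d) (c m) e1, 'd (chart_change c d) (c m) e2) =
    'd (chart_change c d) (c m) (B (e1, e2)) +
    'd (fun x => 'd (chart_change c d) x e2) (c m) e1)//.
  have LE x y : B' ('d (chart_change c d) (c m) x, 'd (chart_change c d) (c m) y) =
      B' (Dmap (chart_change c d) (c m) x, Dmap (chart_change c d) (c m) y).
    by congr (opfun B' (_, _)); exact: dE.
  have RE x y : 'd (chart_change c d) (c m) (B (x, y)) +
      'd (fun z => 'd (chart_change c d) z y) (c m) x =
      Dmap (chart_change c d) (c m) (B (x, y)) +
      Dmap (Dmap (chart_change c d)) (c m) x y.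
    by congr (_ + _); [exact: dE|exact: diff_diff oD FS Dm].
  by split=> H x y; [exact: etrans (esym (LE x y)) (etrans (H x y) (RE x y))|
    exact: etrans (LE x y) (etrans (H x y) (esym (RE x y)))].
split=> [/equivE H|B'E].
  apply: optype_ext => -[x y]; rewrite (christoffel_tr_ptE d _ x y cm).
  apply: etrans (H _ _).
  by congr (opfun B' (_, _)); apply/esym; exact: Dmap_chart_changeK dM cM dm cm _.
apply/equivE => x y; rewrite B'E; apply: etrans (christoffel_tr_ptE d _ _ _ cm) _.
have K := Dmap_chart_changeK cM dM cm dm.
congr (_ + _); first exact: (f_equal2
  (fun v w => Dmap (chart_change c d) (c m) (B (v, w))) (K x) (K y)).
exact: (f_equal2 (fun v w => Dmap (Dmap (chart_change c d)) (c m) v w) (K x) (K y)).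
Qed.

End at_point.
End banach_charts.

(** With L the connecting map of the models and phi that of the manifolds, in
    charts phi is L; hence L intertwines the changes of charts, their first and
    second derivatives, and the transformation laws. *)
Lemma christoffel_tr_natural (R : realType) (E E' : completeNormedModType R)
    (N : banach_manifold E) (N' : banach_manifold E') (phi : N -> N')
    (L : E -> E') (c d : chart N E) (c' d' : chart N' E') (m : N)
    (B : contbil E E) (B' : contbil E' E') : bounded_linear L ->
  manifold_chart c -> manifold_chart d ->
  manifold_chart c' -> manifold_chart d' ->
  (forall x, cdom c x -> cdom c' (phi x) /\ c' (phi x) = L (c x)) ->
  (forall x, cdom d x -> cdom d' (phi x) /\ d' (phi x) = L (d x)) ->
  cdom c m -> cdom d m ->
  (forall x y, B' (L x, L y) = L (B (x, y))) ->
  forall x y, christoffel_tr c' d' (c' (phi m), B') (L x, L y) =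
    L (christoffel_tr c d (c m, B) (x, y)).
Proof.
move=> bL cM dM cM' dM' cL dL cm dm BL x y.
have natural (a b : chart N E) (a' b' : chart N' E') :
    manifold_chart a -> manifold_chart b ->
    manifold_chart a' -> manifold_chart b' ->
    (forall x, cdom a x -> cdom a' (phi x) /\ a' (phi x) = L (a x)) ->
    (forall x, cdom b x -> cdom b' (phi x) /\ b' (phi x) = L (b x)) ->
    cdom a m -> cdom b m ->
    (forall v, Dmap (chart_change a' b') (L (a m)) (L v) =
      L (Dmap (chart_change a b) (a m) v)) /\
    (forall v w, Dmap (Dmap (chart_change a' b')) (L (a m)) (L v) (L w) =
      L (Dmap (Dmap (chart_change a b)) (a m) v w)).
  move=> aM bM aM' bM' aL bL' am bm.
  apply: (Dmap_intertwine bL (overlap_open a b) (overlap_open a' b') _ _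
    (chart_change_smooth aM bM) (chart_change_smooth aM' bM') (overlapP am bm)).
    move=> _ [z [az bz] <-]; have [a'z <-] := aL z az; have [b'z _] := bL' z bz.
    exact: overlapP.
  move=> _ [z [az bz] <-]; have [a'z <-] := aL z az; have [b'z bE] := bL' z bz.
  by rewrite !chart_changeE.
have [cm' cE] := cL m cm; have [dm' dE] := dL m dm.
have [D1 D2] := natural c d c' d' cM dM cM' dM' cL dL cm dm.
have [K _] := natural d c d' c' dM cM dM' cM' dL cL dm cm.
apply: etrans (christoffel_tr_ptE d' B' (L x) (L y) cm') _.
apply: etrans (esym (congr1 L (christoffel_tr_ptE d B x y cm))).
rewrite cE dE.
pose v := Dmap (chart_change d c) (d m) x; pose w := Dmap (chart_change d c) (d m) y.
have Kx : Dmap (chart_change d' c') (L (d m)) (L x) = L v := K x.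
have Ky : Dmap (chart_change d' c') (L (d m)) (L y) = L w := K y.
have LD a b : L (a + b) = L a + L b.
  by have [lL _] := bL; have := lL 1 a b; rewrite !scale1r.
apply: etrans (esym (LD _ _)); congr (_ + _).
  apply: etrans (D1 (B (v, w))); congr (opfun _ _).
  apply: etrans (BL v w); exact: (f_equal2 (fun a b => B' (a, b)) Kx Ky).
apply: etrans (D2 v w).
exact: (f_equal2 (fun a b => Dmap (Dmap (chart_change c' d')) (L (c m)) a b) Kx Ky).
Qed.

(** * The limit manifold *)

Section limit_charts.
Context {R : realType} (S : manifold_system R).
Local Notation E := (ms_model S).
Local Notation F := (bs_lim E).
Implicit Types (c d : chart_family S) (m : ms_lim S) (u : F).

Lemma lim_coord_continuous i :
  continuous (fun m : ms_lim S => (lim_coord m i : S i)).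
Proof.
move=> m.
apply: (@cvg_comp (ms_lim S) (prod_topology (fun i => S i : topologicalType))
  (S i) (@lim_coord R S) (@proj nat (fun i => S i : topologicalType) i)
  (nbhs m) (nbhs (lim_coord m : prod_topology (fun i => S i : topologicalType)))
  (nbhs (lim_coord m i))).
  exact: (@initial_continuous _ _ set_val).
exact: (@proj_continuous nat (fun i => S i : topologicalType) i).
Qed.

Lemma ms_lim_cvg (G : set_system (ms_lim S)) m : Filter G ->
  (forall i, (fun y : ms_lim S => (lim_coord y i : S i)) @ G --> lim_coord m i) ->
  G --> m.
Proof.
move=> FG Gm.
have /= GP : (fun y : ms_lim S =>
    (lim_coord y : prod_topology (fun i => S i : topologicalType))) @ G -->
    (lim_coord m : prod_topology (fun i => S i : topologicalType)).
  apply/cvg_sup => i A [_ [[B oB <-] Bx] BA].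
  have : nbhs (lim_coord m i) B := @open_nbhs_nbhs (S i) _ _ (conj oB Bx).
  move=> /(Gm i); apply: (filterS (F := G)) => y By; exact: BA.
move=> A [_ [[B oB <-] Bx] BA].
have /GP : nbhs (lim_coord m : prod_topology (fun i => S i : topologicalType)) B :=
  @open_nbhs_nbhs (prod_topology (fun i => S i : topologicalType)) _ _ (conj oB Bx).
by apply: (filterS (F := G)) => y By; exact: BA.
Qed.

Lemma ms_lim_ext m m' : (forall i, lim_coord m i = lim_coord m' i) -> m = m'.
Proof. by move=> mm; apply: val_inj; apply: functional_extensionality_dep. Qed.

Lemma lim_coord_map m i j (h : (i <= j)%N) :
  ms_map S h (lim_coord m j) = lim_coord m i.
Proof. exact: (set_valP m). Qed.

Lemma bs_lim_ext (u v : F) :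
  (forall i, subprod_coord u i = subprod_coord v i) -> u = v.
Proof. exact: subprod_ext. Qed.

(** The relation u = phi(m) for the limit chart phi of c, usable before this
    chart has been built as a pair of total functions. *)
Definition at_chart c m (u : F) : Prop :=
  lim_dom c m /\ forall i, subprod_coord u i = c i (lim_coord m i).

Lemma at_chart_inj c m m' u : at_chart c m u -> at_chart c m' u -> m = m'.
Proof.
move=> [cm um] [cm' um']; apply: ms_lim_ext => i.
by rewrite -(cmapK (cm i)) -(cmapK (cm' i)) -um -um'.
Qed.

Lemma at_chart_exists c m : is_chart_system c -> lim_dom c m ->
  exists u, at_chart c m u.
Proof.
move=> [cM cE _ _] cm.
have uT : bs_thread (fun i => c i (lim_coord m i)).
  move=> i j h; have [_ <-] := cE i j h _ (cm j).
  by rewrite lim_coord_map.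
by exists (SubProd (uT :
  lset (LinSet (@bs_thread0 R E) (@bs_threadD R E) (@bs_threadZ R E)) _)).
Qed.

(** The limit chart and its inverse as total functions, with a default value
    outside the domains; the inverse needs a point m0 for this purpose. *)
Definition lim_loc c m : F := xget 0 (at_chart c m).
Definition lim_unloc m0 c u : ms_lim S := xget m0 [set m | at_chart c m u].

Lemma lim_locP c m : is_chart_system c -> lim_dom c m -> at_chart c m (lim_loc c m).
Proof. by move=> cS cm; exact: xgetPex (at_chart_exists cS cm). Qed.

Lemma lim_unlocE m0 c m u : at_chart c m u -> lim_unloc m0 c u = m.
Proof.
move=> cmu; have um : at_chart c (lim_unloc m0 c u) u.
  exact: (@xgetPex _ m0 [set m | at_chart c m u] (ex_intro _ m cmu)).
exact: at_chart_inj um cmu.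
Qed.

Lemma lim_img c : is_chart_system c ->
  lim_loc c @` lim_dom c =
  [set u : F | exists2 m, lim_dom c m &
        forall i, subprod_coord u i = c i (lim_coord m i)].
Proof.
move=> cS; apply/seteqP; split => [_ [m cm <-]|u [m cm um]].
  by have [_ mE] := lim_locP cS cm; exists m.
exists m => //; apply: bs_lim_ext => i.
by rewrite (lim_locP cS cm).2 um.
Qed.

Section chart.
Variables (m0 : ms_lim S) (c : chart_family S) (cS : is_chart_system c).

Fact lim_chart_dom_open : open (lim_dom c).
Proof. by case: cS. Qed.

Fact lim_chart_img_open : open (lim_loc c @` lim_dom c).
Proof. by rewrite lim_img//; case: cS. Qed.

Fact lim_chartK m : lim_dom c m -> lim_unloc m0 c (lim_loc c m) = m.
Proof. by move=> cm; apply: lim_unlocE; exact: lim_locP. Qed.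

Fact lim_chart_continuous : {within lim_dom c, continuous (lim_loc c)}.
Proof.
rewrite continuous_open_subspace; last exact: lim_chart_dom_open.
move=> m /[!inE] cm; have [_ _ cvgF _] := projective_bs_lim E.
have Fm : Filter (nbhs m) by exact: nbhs_filter.
apply: cvgF => i; rewrite (lim_locP cS cm).2.
have cC : (fun y : ms_lim S => c i (lim_coord y i)) @ m --> c i (lim_coord m i).
  apply: (@continuous_comp _ _ _ (fun y : ms_lim S => (lim_coord y i : S i)) (c i)).
    exact: lim_coord_continuous.
  have := @cmap_continuous _ _ (c i).
  rewrite continuous_open_subspace; last exact: cdom_open.
  by apply; rewrite inE; exact: cm.
rewrite -fmap_comp; apply: cvg_trans cC; apply: near_eq_cvg.
apply: filterS (open_nbhs_nbhs (conj lim_chart_dom_open cm)) => y cy.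
by rewrite /= (lim_locP cS cy).2.
Qed.

Fact lim_chart_inv_continuous :
  {within lim_loc c @` lim_dom c, continuous (lim_unloc m0 c)}.
Proof.
rewrite continuous_open_subspace; last exact: lim_chart_img_open.
move=> u /[!inE] -[m cm mu]; have Fu : Filter (nbhs u) by exact: nbhs_filter.
apply: ms_lim_cvg => i.
have cmu : at_chart c m u by rewrite -mu; exact: lim_locP.
rewrite (lim_unlocE m0 cmu).
have cC : (fun v : F => cinv (c i) (subprod_coord v i)) @ u -->
    cinv (c i) (subprod_coord u i).
  apply: (@continuous_comp _ _ _ (fun v : F => (subprod_coord v i : E i)) (cinv (c i))).
    exact: subprod_coord_continuous.
  have := @cinv_continuous _ _ (c i).
  rewrite continuous_open_subspace; last exact: cimg_open.
  by apply; rewrite inE cmu.2; exists (lim_coord m i) => //; exact: cm.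
rewrite cmu.2 (cmapK (cm i)) in cC.
rewrite -fmap_comp; apply: cvg_trans cC; apply: near_eq_cvg.
have oI := lim_chart_img_open.
have uI : (lim_loc c @` lim_dom c) u by exists m.
apply: filterS (open_nbhs_nbhs (conj oI uI)) => _ [y cy <-].
by rewrite /= lim_chartK// (lim_locP cS cy).2 cmapK.
Qed.

Definition lim_chart : chart (ms_lim S) F :=
  Chart lim_chart_dom_open lim_chart_img_open lim_chartK
    lim_chart_continuous lim_chart_inv_continuous.

Lemma lim_chart_atlas : ms_lim_atlas S lim_chart.
Proof. by exists c => //; split=> // m cm i; rewrite /= (lim_locP cS cm).2. Qed.

End chart.

Lemma lim_img_open c (U : set (ms_lim S)) : is_chart_system c -> open U ->
  open [set u : F | exists2 m, U m & at_chart c m u].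
Proof.
move=> cS oU.
have [[m0 cm0]|nc] := pselect (exists m, lim_dom c m); last first.
  rewrite (_ : mkset _ = set0); first exact: open0.
  by apply/seteqP; split => // u [m _ [cm _]]; apply: nc; exists m.
have oc := lim_chart_dom_open cS.
have : open (lim_chart m0 cS @` (U `&` lim_dom c)).
  by apply: chart_open_image; [exact: openI|move=> m []].
congr open; apply/seteqP; split => [_ [m [Um cm] <-]|u [m Um cmu]].
  by exists m => //; exact: lim_locP.
exists m; first by split=> //; case: cmu.
apply: bs_lim_ext => i; rewrite cmu.2.
by have [cm _] := cmu; rewrite /= (lim_locP cS cm).2.
Qed.

(** A map that reads off the base point in the chart b from its coordinates in
    the chart a has components equal to changes of charts. The map pr allows
    its argument to carry further data, such as a bilinear map. *)
Lemma smooth_to_lim (V : tvsType R) (pr : V -> F) (D : set V) (f : V -> F) a b :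
  open D -> linear pr -> continuous pr -> is_chart_system a -> is_chart_system b ->
  (forall z, D z -> exists m, at_chart a m (pr z) /\ at_chart b m (f z)) ->
  frechet_smooth D f.
Proof.
move=> oD prl prc aS bS Df; have [aM _ _ _] := aS; have [bM _ _ _] := bS.
apply: (@frechet_smooth_proj R V F (fun i => E i) (fun i => E i)
  (fun i z => subprod_coord (pr z) i) _ D f oD _ _ (projective_bs_lim E)).
- by move=> i x u v; rewrite prl.
- move=> i z; apply: (@continuous_comp _ _ _ pr (fun u : F => (subprod_coord u i : E i))).
    exact: prc.
  exact: subprod_coord_continuous.
move=> i; exists (overlap (a i) (b i)), (chart_change (a i) (b i)).
split; [exact: overlap_open|exact: chart_change_smooth (aM i) (bM i)|].
move=> z /Df[m [[am zE] [bm fE]]]; rewrite zE fE chart_changeE//.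
by split=> //; exact: overlapP (am i) (bm i).
Qed.

Lemma ms_lim_atlasP C : ms_lim_atlas S C -> exists2 c, is_chart_system c &
  cdom C = lim_dom c /\ forall m, cdom C m -> at_chart c m (C m).
Proof.
move=> [c cS [cD cE]]; exists c => //; split=> // m.
by rewrite cD => cm; split=> //; exact: cE.
Qed.

Lemma ms_lim_frechet_manifold : has_lim_charts S ->
  is_frechet_manifold (ms_lim_atlas S).
Proof.
move=> hcharts; split; first exact: bs_lim_frechet.
split.
  move=> m; have [c cS cm] := hcharts m.
  by exists (lim_chart m cS) => //; exact: lim_chart_atlas.
move=> C D /ms_lim_atlasP[c cS [cD cE]] /ms_lim_atlasP[d dS [dD dE]].
apply: (smooth_to_lim (pr := id) (overlap_open C D) _ _ cS dS) => //.
  by move=> x; exact: cvg_id.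
move=> _ [m [Cm Dm] <-]; exists m; split; first exact: cE.
by rewrite chart_changeE//; exact: dE.
Qed.

End limit_charts.

(** * Charts of the space of Christoffel elements *)

Lemma open_tvsX (R : realType) (V W : tvsType R) (D : set (V * W)) :
  open D -> @open ((V * W)%type : tvsType R) D.
Proof. by []. Qed.

Section limit_christoffel.
Context {R : realType} (S : manifold_system R).
Local Notation E := (ms_model S).
Local Notation F := (bs_lim E).
Local Notation H := (H2 E).
Local Notation CM := (lim_christoffel S).
Implicit Types (c d : chart_family S) (m : ms_lim S) (B : H) (g : CM).

Local Opaque christoffel_tr chart_change.

(** A triple lies in its own class, which gives the law for B'; conversely the
    cocycle property carries the members of one class to the other. *)
Lemma lim_christoffel_class_eq c d m B B' :
  is_chart_system c -> is_chart_system d -> lim_dom c m -> lim_dom d m ->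
  lim_christoffel_class m c B = lim_christoffel_class m d B' <->
  forall i, H2_coord B' i =
    christoffel_tr (c i) (d i) (c i (lim_coord m i), H2_coord B i).
Proof.
move=> cS dS cm dm; have [cM _ _ _] := cS; have [dM _ _ _] := dS.
split=> [cd i|B'E].
  have : lim_christoffel_class m d B' (d, B').
    split; [exact: dS|exact: dm|move=> j].
    apply: (christoffel_equivP _ _ (dM j) (dM j) (dm j) (dm j)).2.
    by apply/esym; apply: christoffel_tr_id; exact: dm.
  rewrite -cd => -[_ _ /(_ i)].
  by move/(christoffel_equivP _ _ (cM i) (dM i) (cm i) (dm i)).
have tr_comp (e : chart_family S) i : manifold_chart (e i) ->
    cdom (e i) (lim_coord m i) ->
    christoffel_tr (c i) (e i) (c i (lim_coord m i), H2_coord B i) =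
    christoffel_tr (d i) (e i) (d i (lim_coord m i), H2_coord B' i).
  move=> eM em; rewrite B'E; apply/esym.
  exact: (christoffel_tr_comp _ (cM i) (dM i) eM (cm i) (dm i) em).
apply/seteqP; split => -[e B''] [eS em eE]; have [eM _ _ _] := eS;
  (split; [exact: eS|exact: em|move=> i]).
  have eB : H2_coord B'' i =
      christoffel_tr (c i) (e i) (c i (lim_coord m i), H2_coord B i).
    exact: (christoffel_equivP _ _ (cM i) (eM i) (cm i) (em i)).1 (eE i).
  apply: (christoffel_equivP _ _ (dM i) (eM i) (dm i) (em i)).2.
  by rewrite -(tr_comp e i (eM i) (em i)).
have eB : H2_coord B'' i =
    christoffel_tr (d i) (e i) (d i (lim_coord m i), H2_coord B' i).
  exact: (christoffel_equivP _ _ (dM i) (eM i) (dm i) (em i)).1 (eE i).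
apply: (christoffel_equivP _ _ (cM i) (eM i) (cm i) (em i)).2.
by rewrite (tr_comp e i (eM i) (em i)).
Qed.

Lemma christoffel_tr_H2 c d m B : is_chart_system c -> is_chart_system d ->
  lim_dom c m -> lim_dom d m ->
  exists B' : H, forall i, H2_coord B' i =
    christoffel_tr (c i) (d i) (c i (lim_coord m i), H2_coord B i).
Proof.
move=> [cM cE _ _] [dM dE _ _] cm dm.
pose B' i := christoffel_tr (c i) (d i) (c i (lim_coord m i), H2_coord B i).
have B'P : H2_set B'.
  move=> i j h e1 e2; rewrite /B' -(lim_coord_map m h).
  apply: (christoffel_tr_natural _ (cM j) (dM j) (cM i) (dM i) (cE i j h) (dE i j h)
    (cm j) (dm j)).
    split; first exact: linearP.
    have [k _ kP] := linear_lipschitz (@bs_map_continuous R E i j h).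
    by exists k.
  by move=> x y; exact: (subprod_coordP B).
by exists (SubProd (B'P : lset (LinSet (@H2_set0 R E) (@H2_setD R E) (@H2_setZ R E)) _)).
Qed.

Lemma christoffel_coord_exists c g : is_chart_system c ->
  lim_dom c (lchr_pt g) -> exists z, christoffel_coord c g z.
Proof.
move=> cS cg; have [d [B [dS dg gE]]] := lchr_classP g.
have [u [_ uE]] := at_chart_exists cS cg.
have [B' B'E] := christoffel_tr_H2 B dS cS dg cg.
exists (u, B'); split; [exact: cg|exact: uE|rewrite gE].
exact: (lim_christoffel_class_eq B B' dS cS dg cg).2.
Qed.

Lemma christoffel_coord_point c m (z : (F * H)%type) : is_chart_system c ->
  at_chart c m z.1 -> exists g, lchr_pt g = m /\ christoffel_coord c g z.
Proof.
move=> cS [cm zE].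
have gP : exists c' B, [/\ is_chart_system c', lim_dom c' m
    & lim_christoffel_class m c z.2 = lim_christoffel_class m c' B].
  by exists c, z.2.
by exists (LimChristoffel gP).
Qed.

Lemma christoffel_coord_at c g z : christoffel_coord c g z ->
  at_chart c (lchr_pt g) z.1.
Proof. by case. Qed.

Lemma christoffel_coord_change c d g z z' :
  is_chart_system c -> is_chart_system d ->
  christoffel_coord c g z -> christoffel_coord d g z' -> forall i,
  H2_coord z'.2 i =
    christoffel_tr (c i) (d i) (c i (lim_coord (lchr_pt g) i), H2_coord z.2 i).
Proof.
move=> cS dS [cg _ gE] [dg _ gE'].
by apply/(lim_christoffel_class_eq _ _ cS dS cg dg); rewrite -gE -gE'.
Qed.

(** The common local form of all the maps of the bundle. The point is given in
    the chart a and returned in the chart b; the bilinear map, given with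
    respect to the chart c, is returned with respect to e. Changes of charts of
    CM have c = a and e = b, a trivialization has c = a, its inverse has
    e = b. *)
Lemma smooth_to_christoffel (D : set (F * H)) (f : F * H -> F * H) a b c e :
  open D -> is_chart_system a -> is_chart_system b ->
  is_chart_system c -> is_chart_system e ->
  (forall z, D z -> exists m, [/\ at_chart a m z.1, at_chart b m (f z).1,
    lim_dom c m, lim_dom e m & forall i, H2_coord (f z).2 i =
      christoffel_tr (c i) (e i) (c i (lim_coord m i), H2_coord z.2 i)]) ->
  frechet_smooth D f.
Proof.
move=> oD [aM _ _ _] [bM _ _ _] [cM _ _ _] [eM _ _ _] Df.
have [lp _ _ _] := projective_bs_lim_H2 E.
apply: (@frechet_smooth_proj R (F * H)%type (F * H)%type
  (fun i => (E i * contbil (E i) (E i))%type)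
  (fun i => (E i * contbil (E i) (E i))%type)
  (fun i z => (subprod_coord z.1 i, subprod_coord z.2 i)) _ D f (open_tvsX oD)
  (fun i => (lp i).1) (fun i => (lp i).2) (projective_bs_lim_H2 E)) => i.
pose dom := cdom (a i) `&` cdom (b i) `&` cdom (c i) `&` cdom (e i).
have odom : open (a i @` dom).
  apply: chart_open_image => [|x [[[]]]//].
  by do 3 (apply: openI; last exact: cdom_open); exact: cdom_open.
pose O := (a i @` dom) `*` [set: contbil (E i) (E i)].
have oO : open O by exact: open_cylinder.
pose tr (w : E i * contbil (E i) (E i)) := (chart_change (a i) (c i) w.1, w.2).
exists O, (fun w => (chart_change (a i) (b i) w.1, christoffel_tr (c i) (e i) (tr w))).
have fstS := banach_smooth_linear oO (bounded_linear_fst _ _).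
have sndS := banach_smooth_linear oO (bounded_linear_snd _ _).
split=> //.
  apply: (banach_smooth_pair oO).
    apply: (banach_smooth_comp oO (overlap_open _ _) _ fstS
      (chart_change_smooth (aM i) (bM i))).
    by move=> w [[x [[[ax bx] cx] ex] <-] _]; exact: overlapP.
  apply: (banach_smooth_comp oO (open_cylinder (overlap_open _ _)) (f := tr) _ _
    (christoffel_tr_smooth (cM i) (eM i))).
    move=> w [[x [[[ax bx] cx] ex] xE] _]; split=> //.
    by rewrite /tr/= -xE chart_changeE//; exact: overlapP.
  apply: (banach_smooth_pair oO) sndS.
  apply: (banach_smooth_comp oO (overlap_open _ _) _ fstS
    (chart_change_smooth (aM i) (cM i))).
  by move=> w [[x [[[ax bx] cx] ex] <-] _]; exact: overlapP.
move=> z /Df[m [[am zE] [bm fE] cm em f2]].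
have zi : subprod_coord z.1 i = a i (lim_coord m i) := zE i.
have fi : subprod_coord (f z).1 i = b i (lim_coord m i) := fE i.
split.
  split; last by [].
  exists (lim_coord m i); last exact: esym zi.
  exact: (conj (conj (conj (am i) (bm i)) (cm i)) (em i)).
have ac : chart_change (a i) (c i) (subprod_coord z.1 i) = c i (lim_coord m i).
  by rewrite zi chart_changeE//; exact: am.
have ab : chart_change (a i) (b i) (subprod_coord z.1 i) = b i (lim_coord m i).
  by rewrite zi chart_changeE//; exact: am.
rewrite /tr/= ab ac fi; congr (_, _); exact: f2.
Qed.

Lemma christoffel_img_open c (U : set (ms_lim S)) : is_chart_system c -> open U ->
  open [set z : (F * H)%type | exists2 m, U m & at_chart c m z.1].
Proof.
move=> cS oU; apply: (@open_comp _ _ (@fst F H)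
  [set u | exists2 m, U m & at_chart c m u]); first by move=> z _; exact: cvg_fst.
exact: lim_img_open.
Qed.

Lemma open_christoffelE (U : set CM) : open U = christoffel_open U.
Proof. by []. Qed.

(** In every chart the inverse image of an open set is a cylinder. *)
Lemma lchr_pt_continuous : continuous (@lchr_pt R S).
Proof.
apply/continuousP => U oU; rewrite open_christoffelE => c cS.
have := christoffel_img_open cS oU.
congr open; apply/seteqP; split => [z [m Um cm]|z [g Ug gz]].
  by have [g [gm gz]] := christoffel_coord_point cS cm; exists g; rewrite //= gm.
by exists (lchr_pt g) => //; exact: christoffel_coord_at gz.
Qed.

Definition christoffel_loc c g : (F * H)%type := xget 0 (christoffel_coord c g).
Definition christoffel_unloc g0 c (z : (F * H)%type) : CM :=
  xget g0 [set g | christoffel_coord c g z].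

Lemma christoffel_locP c g : is_chart_system c -> lim_dom c (lchr_pt g) ->
  christoffel_coord c g (christoffel_loc c g).
Proof. by move=> cS cg; exact: xgetPex (christoffel_coord_exists cS cg). Qed.

Lemma christoffel_unlocE g0 c g z : christoffel_coord c g z ->
  christoffel_unloc g0 c z = g.
Proof.
move=> gz; have gz' : christoffel_coord c (christoffel_unloc g0 c z) z.
  exact: (@xgetPex _ g0 [set g | christoffel_coord c g z] (ex_intro _ g gz)).
exact: christoffel_coord_inj gz' gz.
Qed.

(** The transformation law from a chart to itself is the identity. *)
Lemma christoffel_coord_uniq c g z z' : is_chart_system c ->
  christoffel_coord c g z -> christoffel_coord c g z' -> z = z'.
Proof.
move=> cS gz gz'; have [cg zE _] := gz; have [_ zE' _] := gz'.
case: z z' gz gz' zE zE' => [u B] [u' B'] gz gz' /= zE zE'; congr (_, _).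
  by apply: subprod_ext => i; rewrite zE zE'.
apply: subprod_ext => i; apply/esym.
apply: etrans (christoffel_coord_change cS cS gz gz' i) _.
by apply: christoffel_tr_id; exact: cg.
Qed.

Section chart.
Variables (g0 : CM) (c : chart_family S) (cS : is_chart_system c).
Let dom := [set g : CM | lim_dom c (lchr_pt g)].

Fact christoffel_chart_dom_open : open dom.
Proof.
apply: (@open_comp _ _ (@lchr_pt R S)); last exact: lim_chart_dom_open cS.
by move=> g _; exact: lchr_pt_continuous.
Qed.

Fact christoffel_chart_img : christoffel_loc c @` dom =
  [set z : (F * H)%type | exists2 m, setT m & at_chart c m z.1].
Proof.
apply/seteqP; split => [_ [g cg <-]|z [m _ cm]].
  by exists (lchr_pt g) => //; exact: christoffel_coord_at (christoffel_locP cS cg).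
have [g [gm gz]] := christoffel_coord_point cS cm.
have cg : dom g by case: gz.
by exists g => //; exact: christoffel_coord_uniq cS (christoffel_locP cS cg) gz.
Qed.

Fact christoffel_chart_img_open : open (christoffel_loc c @` dom).
Proof. by rewrite christoffel_chart_img; exact: (christoffel_img_open cS openT). Qed.

Fact christoffel_chartK g : dom g -> christoffel_unloc g0 c (christoffel_loc c g) = g.
Proof. by move=> cg; apply: christoffel_unlocE; exact: christoffel_locP. Qed.

(** Openness in CM is tested in each chart system d, where the chart of c
    becomes a change of coordinates, which is continuous because it is
    smooth. *)
Fact christoffel_chart_continuous : {within dom, continuous (christoffel_loc c)}.
Proof.
rewrite continuous_open_subspace; last exact: christoffel_chart_dom_open.
apply/(continuous_inP _ christoffel_chart_dom_open) => X oX.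
rewrite open_christoffelE => d dS.
pose D := [set z : (F * H)%type | exists2 m, lim_dom c m & at_chart d m z.1].
have oD : open D by apply: christoffel_img_open => //; exact: lim_chart_dom_open.
(* The change of coordinates from d to c. *)
pose T := christoffel_loc c \o christoffel_unloc g0 d.
have TS : frechet_smooth D T.
  apply: (smooth_to_christoffel oD dS cS dS cS) => z [m cm dmz].
  have [g [gm gz]] := christoffel_coord_point dS dmz.
  have cg : dom g by rewrite /dom/= gm.
  have TE : T z = christoffel_loc c g by rewrite /T/= (christoffel_unlocE g0 gz).
  have gTz := christoffel_locP cS cg.
  exists (lchr_pt g); rewrite TE; split.
  - exact: christoffel_coord_at gz.
  - exact: christoffel_coord_at gTz.
  - by case: gz.
  - exact: cg.
  - exact: christoffel_coord_change dS cS gz gTz.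
have TC : {within D, continuous T} by exact: frechet_Ck_cont (TS 0%N).
rewrite (continuous_open_subspace _ oD) in TC.
have oDX := (continuous_inP _ oD).1 TC X oX.
rewrite (_ : mkset _ = D `&` T @^-1` X); first exact: oDX.
apply/seteqP; split => [z [g [cg Xg] gz]|z [[m cm dmz] Xz]].
  split; first by exists (lchr_pt g); [exact: cg|exact: christoffel_coord_at gz].
  by rewrite /T/= (christoffel_unlocE g0 gz).
have [g [gm gz]] := christoffel_coord_point dS dmz.
exists g; last exact: gz.
split; first by rewrite /dom/= gm.
by move: Xz; rewrite /T/= (christoffel_unlocE g0 gz).
Qed.

(** The topology of CM is defined by this property. *)
Fact christoffel_chart_inv_continuous :
  {within christoffel_loc c @` dom, continuous (christoffel_unloc g0 c)}.
Proof.
rewrite continuous_open_subspace; last exact: christoffel_chart_img_open.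
apply/(continuous_inP _ christoffel_chart_img_open) => X oX.
have oXc : christoffel_open X by exact: oX.
rewrite (_ : _ `&` _ = [set z | exists2 g, X g & christoffel_coord c g z]).
  exact: oXc c cS.
apply/seteqP; split => [z [[g cg <-]] /= Xz|z [g Xg gz]].
  by exists g; [move: Xz; rewrite christoffel_chartK|exact: christoffel_locP].
have cg : dom g by case: gz.
split; last by rewrite /= (christoffel_unlocE g0 gz).
by exists g => //; exact: christoffel_coord_uniq cS (christoffel_locP cS cg) gz.
Qed.

Definition christoffel_chart : chart CM (F * H)%type :=
  Chart christoffel_chart_dom_open christoffel_chart_img_open christoffel_chartK
    christoffel_chart_continuous christoffel_chart_inv_continuous.

Lemma christoffel_chart_atlas : lim_christoffel_atlas S christoffel_chart.
Proof. by exists c => //; split=> // g cg; exact: christoffel_locP. Qed.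

End chart.
End limit_christoffel.

(** * The bundle of Christoffel elements *)

Section christoffel_bundle.
Context {R : realType} (S : manifold_system R).
Local Notation E := (ms_model S).
Local Notation F := (bs_lim E).
Local Notation H := (H2 E).
Local Notation CM := (lim_christoffel S).
Hypothesis hcharts : has_lim_charts S.

Local Opaque christoffel_tr chart_change bs_lim H2.

Lemma lim_christoffel_atlasP C : lim_christoffel_atlas S C ->
  exists2 c, is_chart_system c & cdom C = [set g | lim_dom c (lchr_pt g)] /\
    forall g, cdom C g -> christoffel_coord c g (C g).
Proof.
move=> [c cS [cD cE]]; exists c => //; split=> // g.
by rewrite cD => cg; exact: cE.
Qed.

Lemma lchr_pt_surj m : exists g : CM, lchr_pt g = m.
Proof.
have [c cS cm] := hcharts m; have [u mu] := at_chart_exists cS cm.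
by have [g [gm _]] := christoffel_coord_point (z := (u, 0)) cS mu; exists g.
Qed.

Lemma lim_christoffel_frechet_manifold :
  is_frechet_manifold (lim_christoffel_atlas S).
Proof.
split; first exact: bs_lim_H2_frechet.
split.
  move=> g; have [c cS cg] := hcharts (lchr_pt g).
  by exists (christoffel_chart g cS) => //; exact: christoffel_chart_atlas.
move=> C D /lim_christoffel_atlasP[c cS [cD cE]] /lim_christoffel_atlasP[d dS [dD dE]].
apply: (smooth_to_christoffel (overlap_open C D) cS dS cS dS).
move=> _ [g [Cg Dg] <-]; rewrite chart_changeE//.
have gC := cE g Cg; have gD := dE g Dg.
exists (lchr_pt g); split.
- exact: christoffel_coord_at gC.
- exact: christoffel_coord_at gD.
- by case: gC.
- by case: gD.
- exact: christoffel_coord_change cS dS gC gD.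
Qed.

Lemma lchr_pt_smooth :
  manifold_smooth_on (@frechet_smooth R (F * H)%type F)
    (lim_christoffel_atlas S) (ms_lim_atlas S) setT (@lchr_pt R S).
Proof.
split; first by apply: continuous_subspaceT; exact: lchr_pt_continuous.
move=> C D /lim_christoffel_atlasP[c cS [cD cE]] /ms_lim_atlasP[d dS [dD dE]].
set A := cdom C `&` _ `&` _.
have oA : open A.
  apply: openI; first by apply: openI; [exact: cdom_open|exact: openT].
  apply: open_comp; last exact: cdom_open.
  by move=> g _; exact: lchr_pt_continuous.
have oCA : open (C @` A) by apply: chart_open_image => // g [[]].
apply: (@smooth_to_lim R S (F * H)%type fst _ _ c d (open_tvsX oCA) _ _ cS dS).
- by [].
- by move=> z; exact: cvg_fst.
move=> _ [g [[Cg _] Dg] <-]; exists (lchr_pt g).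
split; first exact: christoffel_coord_at (cE g Cg).
by rewrite /= cmapK//; exact: dE.
Qed.

Section trivialization.
Variables (g0 : CM) (c : chart_family S) (cS : is_chart_system c).
Local Notation U := (lim_dom c).

(** The local trivialization over the domain of c, and its inverse
    (m, B) |-> [c, B] at m. *)
Definition triv (g : CM) : ms_lim S * H := (lchr_pt g, (christoffel_loc c g).2).
Definition untriv (z : ms_lim S * H) : CM := christoffel_unloc g0 c (lim_loc c z.1, z.2).

Lemma untrivP m h : U m -> lchr_pt (untriv (m, h)) = m /\
  christoffel_coord c (untriv (m, h)) (lim_loc c m, h).
Proof.
move=> cm; have [g [gm gz]] := christoffel_coord_point
  (z := (lim_loc c m, h)) cS (lim_locP cS cm).
by rewrite /untriv (christoffel_unlocE g0 gz).
Qed.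

Lemma untrivK m h : U m -> triv (untriv (m, h)) = (m, h).
Proof.
move=> cm; have [gm gz] := untrivP h cm.
have cg : U (lchr_pt (untriv (m, h))) by rewrite gm.
rewrite /triv gm; congr (_, _).
by rewrite (christoffel_coord_uniq cS (christoffel_locP cS cg) gz).
Qed.

Lemma trivK g : U (lchr_pt g) -> untriv (triv g) = g.
Proof.
move=> cg; have gz := christoffel_locP cS cg.
apply: christoffel_unlocE => /=.
suff -> : lim_loc c (lchr_pt g) = (christoffel_loc c g).1.
  by case: (christoffel_loc c g) gz.
have [_ uE] := lim_locP cS cg; have [_ zE _] := gz.
by apply: bs_lim_ext => i; rewrite uE zE.
Qed.

Lemma triv_continuous : {within lchr_pt @^-1` U, continuous triv}.
Proof.
have oD : open (@lchr_pt R S @^-1` U) := christoffel_chart_dom_open cS.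
rewrite (continuous_open_subspace _ oD) => g /[!inE] Ug.
have := christoffel_chart_continuous g0 cS.
rewrite (continuous_open_subspace _ oD) => /(_ g); rewrite inE => /(_ Ug) locC.
have Fg : Filter (nbhs g) by exact: nbhs_filter.
have sndC : (fun y => (christoffel_loc c y).2) @ g --> (christoffel_loc c g).2.
  apply: (@continuous_comp _ _ _ (christoffel_loc c) snd); first exact: locC.
  exact: cvg_snd.
have ptC : @lchr_pt R S @ g --> lchr_pt g by exact: lchr_pt_continuous.
exact: cvg_pair ptC sndC.
Qed.

Lemma untriv_continuous : {within U `*` [set: H], continuous untriv}.
Proof.
have oU := lim_chart_dom_open cS.
rewrite continuous_open_subspace; last exact: open_cylinder.
move=> z /[!inE] -[Uz _].
have := @christoffel_chart_inv_continuous R S g0 c cS.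
rewrite continuous_open_subspace; last exact: christoffel_chart_img_open.
move=> unC.
apply: (@continuous_comp _ _ _ (fun z : ms_lim S * H => (lim_loc c z.1, z.2))
  (christoffel_unloc g0 c)).
  have := within_cylinder (H := H) (lim_chart_continuous cS) oU.
  rewrite continuous_open_subspace; last exact: open_cylinder.
  by apply; rewrite inE.
apply: unC; rewrite inE (christoffel_chart_img cS).
by exists z.1; [by []|exact: lim_locP].
Qed.

Lemma triv_smooth :
  manifold_smooth_on (@frechet_smooth R (F * H)%type (F * H)%type)
    (lim_christoffel_atlas S) [set prod_chart H D | D in ms_lim_atlas S]
    (lchr_pt @^-1` U) triv.
Proof.
split; first exact: triv_continuous.
move=> C _ /lim_christoffel_atlasP[d dS [dD dE]] [D /ms_lim_atlasP[b bS [bD bE]] <-].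
set A := cdom C `&` _ `&` _.
have AE : A = cdom C `&` lchr_pt @^-1` U `&` lchr_pt @^-1` (cdom D).
  by apply/seteqP; split => [g [[Cg Ug] [Dg _]]|g [[Cg Ug] Dg]].
have oA : open A.
  rewrite AE; apply: openI; first apply: openI.
  - exact: cdom_open.
  - exact: christoffel_chart_dom_open cS.
  - apply: open_comp; last exact: cdom_open.
    by move=> g _; exact: lchr_pt_continuous.
have oCA : open (C @` A) by apply: chart_open_image => // g [[]].
apply: (smooth_to_christoffel oCA dS bS dS cS).
move=> _ [g + <-]; rewrite AE => -[[Cg Ug] Dg].
have gC := dE g Cg; have gz := christoffel_locP cS Ug.
rewrite /= cmapK//; exists (lchr_pt g); split.
- exact: christoffel_coord_at gC.
- exact: bE.
- by case: gC.
- exact: Ug.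
- exact: christoffel_coord_change dS cS gC gz.
Qed.

Lemma untriv_smooth :
  manifold_smooth_on (@frechet_smooth R (F * H)%type (F * H)%type)
    [set prod_chart H D | D in ms_lim_atlas S] (lim_christoffel_atlas S)
    (U `*` setT) untriv.
Proof.
split; first exact: untriv_continuous.
move=> _ C [D /ms_lim_atlasP[b bS [bD bE]] <-] /lim_christoffel_atlasP[d dS [dD dE]].
set A := cdom _ `&` _ `&` _.
have AE : A = (cdom D `&` U `&` lim_dom d) `*` [set: H].
  apply/seteqP; split => [[m h] [[[Dm _] [/= Um _]]]|[m h] [[[Dm Um] dm] _]].
    by rewrite /= dD /= (untrivP h Um).1.
  by split; [|rewrite /= dD /= (untrivP h Um).1].
have oA : open A.
  rewrite AE; apply: open_cylinder; apply: openI; first apply: openI.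
  - exact: cdom_open.
  - exact: lim_chart_dom_open.
  - exact: lim_chart_dom_open.
have oCA : open (prod_chart H D @` A) by apply: chart_open_image => // g [[]].
apply: (smooth_to_christoffel oCA bS dS cS dS).
move=> _ [[m h] + <-]; rewrite AE => -[/= [[Dm Um] dm] _].
have [gm gz] := untrivP h Um.
have Cg : cdom C (untriv (m, h)) by rewrite dD /= gm.
have gC := dE _ Cg.
rewrite /= cmapK//; exists m; split.
- exact: bE.
- by have := christoffel_coord_at gC; rewrite gm.
- exact: Um.
- exact: dm.
- by move=> i; have := christoffel_coord_change cS dS gz gC i; rewrite gm.
Qed.

End trivialization.

End christoffel_bundle.

Local Opaque christoffel_tr chart_change bs_lim H2.

Theorem theorem2p7 (R : realType) (S : manifold_system R)
    (hcharts : has_lim_charts S) (hC : christoffel_lim_exists S) :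
  is_frechet_fibre_bundle (H2 (ms_model S))
    (ms_lim_atlas S) (lim_christoffel_atlas S) (@lchr_pt R S).
Proof.
split.
- exact: ms_lim_frechet_manifold.
- exact: lim_christoffel_frechet_manifold.
- exact: H2_frechet.
- split; last exact: lchr_pt_smooth.
  by move=> m _; have [g <-] := lchr_pt_surj hcharts m; exists g.
move=> m; have [c cS cm] := hcharts m; have [g0 _] := lchr_pt_surj hcharts m.
exists (lim_dom c); split; [exact: lim_chart_dom_open|exact: cm|].
exists (triv c), (untriv g0 c); split.
- exact: triv_smooth.
- exact: untriv_smooth.
- by move=> g cg; split=> //; exact: trivK.
- by move=> x h cx; split; [exact: (untrivP _ _ _ _).1|exact: untrivK].
Qed.
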